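(* Let $\phi$ be a non-constant analytic map of $\mathbb{D}$ into $\mathbb{D}$. Then $\phi$ is a finite Blaschke product if and only if there exist $\alpha>0$ with $\alpha\neq 1$ and $c>0$ such that $\tau_{\phi,\alpha}$ is bounded on $\mathbb{D}$ and such that for (Lebesgue) almost every $\zeta\in\partial\mathbb{D}$ $$\angle\liminf_{z\to\zeta}\tau_{\phi,\alpha}(z)\ \ge\ c.$$
   Context: $\mathbb{D}$ is the open unit disk in $\mathbb{C}$. For a non-constant analytic $\phi:\mathbb{D}\to\mathbb{D}$ and $\alpha>0$, the local $\alpha$-hyperbolic distortion is $$\tau_{\phi,\alpha}(z)=\frac{(1-|z|^2)^{\alpha}|\phi'(z)|}{(1-|\phi(z)|^2)^{\alpha}},\qquad z\in\mathbb{D}.$$ For $\zeta\in\partial\mathbb{D}$ and $\gamma>1$ the angular (non-tangential) region is $\Gamma_\gamma(\zeta)=\{z\in\mathbb{D}:|\zeta-z|\le\gamma(1-|z|^2)\}$. For a function $f$ on $\mathbb{D}$, $\angle\liminf_{z\to\zeta}f(z)\ge c$ means that for every $\gamma>1$, $\liminf f(z)\ge c$ as $z\to\zeta$ with $z\in\Gamma_\gamma(\zeta)$; angular limits $\angle\lim_{z\to\zeta}$ are defined analogously (limit along every $\Gamma_\gamma(\zeta)$, $\gamma>1$). *)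

(* Defs.v *)
From Stdlib Require Import Reals Lra List.
Open Scope R_scope.

Definition Cplx : Type := (R * R)%type.

Definition Cre (z : Cplx) : R := fst z.
Definition Cim (z : Cplx) : R := snd z.
Definition Cadd (z w : Cplx) : Cplx := (fst z + fst w, snd z + snd w).
Definition Copp (z : Cplx) : Cplx := (- fst z, - snd z).
Definition Csub (z w : Cplx) : Cplx := Cadd z (Copp w).
Definition Cmul (z w : Cplx) : Cplx :=
  (fst z * fst w - snd z * snd w, fst z * snd w + snd z * fst w).
Definition Cconj (z : Cplx) : Cplx := (fst z, - snd z).
Definition Cnorm2 (z : Cplx) : R := fst z * fst z + snd z * snd z.
Definition Cinv (z : Cplx) : Cplx := (fst z / Cnorm2 z, - snd z / Cnorm2 z).
Definition Cdiv (z w : Cplx) : Cplx := Cmul z (Cinv w).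
Definition Cmod (z : Cplx) : R := sqrt (Cnorm2 z).
Definition C1 : Cplx := (1, 0).
Definition Cexpi (t : R) : Cplx := (cos t, sin t).

Definition in_disk (z : Cplx) : Prop := Cmod z < 1.

Definition has_cderiv (f : Cplx -> Cplx) (z l : Cplx) : Prop :=
  forall eps, 0 < eps -> exists delta, 0 < delta /\
    forall w, 0 < Cmod (Csub w z) < delta ->
      Cmod (Csub (Cdiv (Csub (f w) (f z)) (Csub w z)) l) < eps.

Definition blaschke_factor (a z : Cplx) : Cplx :=
  Cdiv (Csub z a) (Csub C1 (Cmul (Cconj a) z)).

Definition blaschke (c : Cplx) (l : list Cplx) (z : Cplx) : Cplx :=
  Cmul c (fold_right (fun a acc => Cmul (blaschke_factor a z) acc) C1 l).

Definition is_finite_blaschke (phi : Cplx -> Cplx) : Prop :=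
  exists (c : Cplx) (l : list Cplx),
    Cmod c = 1 /\ (forall a, In a l -> in_disk a) /\
    forall z, in_disk z -> phi z = blaschke c l z.

Definition tau (phi dphi : Cplx -> Cplx) (alpha : R) (z : Cplx) : R :=
  Rpower (1 - Cmod z ^ 2) alpha * Cmod (dphi z)
  / Rpower (1 - Cmod (phi z) ^ 2) alpha.

Definition stolz (gamma : R) (zeta z : Cplx) : Prop :=
  in_disk z /\ Cmod (Csub zeta z) <= gamma * (1 - Cmod z ^ 2).

Definition ang_liminf_ge (f : Cplx -> R) (zeta : Cplx) (c : R) : Prop :=
  forall gamma, 1 < gamma ->
  forall eps, 0 < eps -> exists delta, 0 < delta /\
    forall z, stolz gamma zeta z -> Cmod (Csub z zeta) < delta ->
      c - eps <= f z.

Definition null_set (E : R -> Prop) : Prop :=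
  forall eps, 0 < eps -> exists a b : nat -> R,
    (forall n, a n <= b n) /\
    (forall N, sum_f_R0 (fun n => b n - a n) N <= eps) /\
    (forall x, E x -> exists n, a n < x < b n).

Definition ae_circle (P : Cplx -> Prop) : Prop :=
  null_set (fun t => ~ P (Cexpi t)).

(* Main.v *)
(** Write u = (1 - |phi|^2) / (1 - |z|^2); then tau_alpha = |phi'| / u^alpha, and
    |phi'| <= u by Schwarz-Pick.

    Suppose tau_alpha <= M everywhere and liminf tau_alpha >= c at the points of a
    dense subset of the circle (density is all that "almost every" is used for).
    Near each such point zeta there are z with u(z) <= K, where K depends only on
    alpha, c and M.  For alpha > 1 this is read off from c/2 <= tau_alpha <= u^(1 - alpha).
    For alpha < 1 it follows from tau_alpha <= M at any z with |phi'(z)| >= u(z) / 2, and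
    such a z exists in every large hyperbolic disk on which tau_alpha >= c/2: otherwise
    phi would move along the radii of the disk at hyperbolic speed at most 1/2, and
    the maximum principle for the reciprocal of the derivative of phi (recentred at the
    middle of the disk) would contradict c/2 <= tau_alpha <= M.  Stolz regions of large
    aperture contain such disks.  Julia's lemma then gives
    1 - |phi(z)| <= 8 K (1 - |z|) on the whole disk, so only finitely many zeros can be
    divided out of phi, and the zero-free quotient is unimodular, hence constant.

    Conversely, for a finite Blaschke product u is bounded above and below and
    |phi'| is bounded below near the circle, because the real part of z phi'/phi is a
    sum of positive terms there; hence alpha = 2 works.

    Derivatives are only assumed to exist pointwise, so Cauchy theory starts from
    Goursat's subdivision argument. *)

From Stdlib Require Import Reals Lra Psatz Classical ClassicalEpsilon List.
From Coquelicot Require Import Coquelicot.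
Open Scope R_scope.

(** * Complex derivatives *)

(** At alpha = 1 the scheme collapses: Schwarz-Pick gives tau <= 1 for every phi, and tau no longer
    ties |phi'| to the size of u. For alpha < 1 the lower bound alone yields u^(1 - alpha) >= c/2,
    the wrong direction; the upper bound must do the work, and it needs a point where |phi'| is
    comparable to u. In the search for that point the lower bound keeps the recentred derivative
    psi' free of zeros, so 1 / psi' is holomorphic, and slow motion keeps u^alpha (1 - |z|^2) so
    large relative to 1 - r^2 on the circle of radius r that |psi'| there exceeds |psi'(0)|. Both
    sides carry the factor u(z0)^alpha (1 - |z0|^2), which is why r depends on alpha, c and M but
    not on the centre z0. The speed 1/2 stands for any number below 1; it produces the exponent
    alpha/2 of 1 - r. Density of the good boundary points is enough because the Julia inequality at
    z uses a single point p within 1 - |z| of the boundary point in the direction of z. *)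

Definition cderiv (f : C -> C) (z l : C) : Prop :=
  forall eps, 0 < eps -> exists d, 0 < d /\ forall w, Cmod (w - z) < d ->
    Cmod (f w - f z - l * (w - z)) <= eps * Cmod (w - z).

Lemma Cmod_sub_sym (a b : C) : Cmod (a - b) = Cmod (b - a).
Proof. rewrite <- Cmod_opp. f_equal. ring. Qed.

Lemma Cmod_sub_triangle (a b : C) : Cmod (a - b) <= Cmod a + Cmod b.
Proof. rewrite <- (Cmod_opp b). apply Cmod_triangle. Qed.

Lemma Cmod_triangle_inv (a b : C) : Cmod a - Cmod b <= Cmod (a - b).
Proof.
  pose proof (Cmod_triangle (a - b) b) as H.
  replace (a - b + b)%C with a in H by ring. lra.
Qed.

Lemma cderiv_const (c z : C) : cderiv (fun _ => c) z 0.
Proof.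
  intros eps He; exists 1; split; [lra|]; intros w _.
  replace (c - c - 0 * (w - z))%C with (RtoC 0) by ring.
  rewrite Cmod_0. pose proof (Cmod_ge_0 (w - z)); nra.
Qed.

Lemma cderiv_id (z : C) : cderiv (fun w => w) z 1.
Proof.
  intros eps He; exists 1; split; [lra|]; intros w _.
  replace (w - z - 1 * (w - z))%C with (RtoC 0) by ring.
  rewrite Cmod_0. pose proof (Cmod_ge_0 (w - z)); nra.
Qed.

Lemma cderiv_plus (f g : C -> C) (z lf lg : C) :
  cderiv f z lf -> cderiv g z lg -> cderiv (fun w => f w + g w)%C z (lf + lg).
Proof.
  intros Hf Hg eps He.
  destruct (Hf (eps / 2)) as [d1 [Hd1 H1]]; [lra|].
  destruct (Hg (eps / 2)) as [d2 [Hd2 H2]]; [lra|].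
  exists (Rmin d1 d2); split; [apply Rmin_pos; assumption|]. intros w Hw.
  pose proof (Rmin_l d1 d2); pose proof (Rmin_r d1 d2).
  specialize (H1 w ltac:(lra)); specialize (H2 w ltac:(lra)).
  replace (f w + g w - (f z + g z) - (lf + lg) * (w - z))%C
    with ((f w - f z - lf * (w - z)) + (g w - g z - lg * (w - z)))%C by ring.
  eapply Rle_trans; [apply Cmod_triangle|]. lra.
Qed.

Lemma cderiv_lip (f : C -> C) (z l : C) : cderiv f z l ->
  exists d, 0 < d /\ forall w, Cmod (w - z) < d ->
    Cmod (f w - f z) <= (Cmod l + 1) * Cmod (w - z).
Proof.
  intros Hf. destruct (Hf 1 Rlt_0_1) as [d [Hd H]].
  exists d; split; [assumption|]. intros w Hw. specialize (H w Hw).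
  replace (f w - f z)%C with ((f w - f z - l * (w - z)) + l * (w - z))%C by ring.
  eapply Rle_trans; [apply Cmod_triangle|]. rewrite Cmod_mult. lra.
Qed.

Lemma cderiv_cont (f : C -> C) (z l : C) : cderiv f z l ->
  forall eps, 0 < eps -> exists d, 0 < d /\ forall w, Cmod (w - z) < d ->
    Cmod (f w - f z) < eps.
Proof.
  intros Hf eps He. destruct (cderiv_lip _ _ _ Hf) as [d [Hd H]].
  pose proof (Cmod_ge_0 l).
  exists (Rmin d (eps / (Cmod l + 1))); split.
  { apply Rmin_pos; [assumption|]. apply Rdiv_lt_0_compat; lra. }
  intros w Hw. pose proof (Rmin_l d (eps / (Cmod l + 1))).
  pose proof (Rmin_r d (eps / (Cmod l + 1))).
  eapply Rle_lt_trans; [apply H; lra|].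
  replace eps with ((Cmod l + 1) * (eps / (Cmod l + 1))) at 1 by (field; lra).
  apply Rmult_lt_compat_l; lra.
Qed.

Lemma cderiv_mult (f g : C -> C) (z lf lg : C) :
  cderiv f z lf -> cderiv g z lg ->
  cderiv (fun w => f w * g w)%C z (lf * g z + f z * lg).
Proof.
  intros Hf Hg eps He.
  pose proof (Cmod_ge_0 lf) as P1. pose proof (Cmod_ge_0 (f z)) as P2.
  pose proof (Cmod_ge_0 (g z)) as P3.
  set (K := Cmod lf + Cmod (f z) + Cmod (g z) + 2).
  assert (HK : 0 < K) by (unfold K; lra).
  assert (He' : 0 < Rmin 1 (eps / K)).
  { apply Rmin_pos; [lra|]. apply Rdiv_lt_0_compat; assumption. }
  destruct (Hf _ He') as [d1 [Hd1 H1]].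
  destruct (Hg _ He') as [d2 [Hd2 H2]].
  destruct (cderiv_cont _ _ _ Hg _ He') as [d3 [Hd3 H3]].
  exists (Rmin d1 (Rmin d2 d3)); split; [repeat apply Rmin_pos; assumption|].
  intros w Hw.
  pose proof (Rmin_l d1 (Rmin d2 d3)); pose proof (Rmin_r d1 (Rmin d2 d3)).
  pose proof (Rmin_l d2 d3); pose proof (Rmin_r d2 d3).
  specialize (H1 w ltac:(lra)); specialize (H2 w ltac:(lra));
  specialize (H3 w ltac:(lra)).
  pose proof (Rmin_l 1 (eps / K)) as E1. pose proof (Rmin_r 1 (eps / K)) as E2.
  set (e := Rmin 1 (eps / K)) in *.
  pose proof (Cmod_ge_0 (w - z)) as P4.
  replace (f w * g w - f z * g z - (lf * g z + f z * lg) * (w - z))%C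
    with ((f w - f z - lf * (w - z)) * g w + (lf * (w - z)) * (g w - g z)
          + f z * (g w - g z - lg * (w - z)))%C by ring.
  assert (G : Cmod (g w) <= Cmod (g z) + 1).
  { replace (g w) with ((g w - g z) + g z)%C by ring.
    eapply Rle_trans; [apply Cmod_triangle|]. lra. }
  eapply Rle_trans; [apply Cmod_triangle|].
  eapply Rle_trans; [apply Rplus_le_compat_r, Cmod_triangle|].
  rewrite !Cmod_mult.
  assert (T1 : Cmod (f w - f z - lf * (w - z)) * Cmod (g w)
               <= (e * Cmod (w - z)) * (Cmod (g z) + 1)).
  { apply Rmult_le_compat; auto using Cmod_ge_0. }
  assert (T2 : Cmod lf * Cmod (w - z) * Cmod (g w - g z) <= Cmod lf * Cmod (w - z) * e).
  { apply Rmult_le_compat_l; [apply Rmult_le_pos; assumption|lra]. }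
  assert (T3 : Cmod (f z) * Cmod (g w - g z - lg * (w - z))
               <= Cmod (f z) * (e * Cmod (w - z))).
  { apply Rmult_le_compat_l; assumption. }
  apply Rle_trans with ((K * e) * Cmod (w - z)).
  { unfold K. assert (0 <= e * Cmod (w - z)) by (apply Rmult_le_pos; lra). nra. }
  apply Rmult_le_compat_r; [assumption|].
  replace eps with (K * (eps / K)) by (field; lra).
  apply Rmult_le_compat_l; lra.
Qed.

(** The product form of [cderiv] admits zero increments, so no case distinction arises where g
    repeats the value g z. *)
Lemma cderiv_comp (f g : C -> C) (z lf lg : C) :
  cderiv f (g z) lf -> cderiv g z lg -> cderiv (fun w => f (g w)) z (lf * lg).
Proof.
  intros Hf Hg eps He.
  pose proof (Cmod_ge_0 lf) as P1. pose proof (Cmod_ge_0 lg) as P2.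
  destruct (Hf (eps / (2 * (Cmod lg + 1)))) as [d1 [Hd1 H1]].
  { apply Rdiv_lt_0_compat; lra. }
  destruct (Hg (eps / (2 * (Cmod lf + 1)))) as [d2 [Hd2 H2]].
  { apply Rdiv_lt_0_compat; lra. }
  destruct (cderiv_lip _ _ _ Hg) as [d3 [Hd3 H3]].
  destruct (cderiv_cont _ _ _ Hg _ Hd1) as [d4 [Hd4 H4]].
  exists (Rmin d2 (Rmin d3 d4)); split; [repeat apply Rmin_pos; assumption|].
  intros w Hw.
  pose proof (Rmin_l d2 (Rmin d3 d4)); pose proof (Rmin_r d2 (Rmin d3 d4)).
  pose proof (Rmin_l d3 d4); pose proof (Rmin_r d3 d4).
  specialize (H2 w ltac:(lra)); specialize (H3 w ltac:(lra));
  specialize (H4 w ltac:(lra)). specialize (H1 _ H4).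
  pose proof (Cmod_ge_0 (w - z)) as P4.
  replace (f (g w) - f (g z) - lf * lg * (w - z))%C
    with ((f (g w) - f (g z) - lf * (g w - g z)) + lf * (g w - g z - lg * (w - z)))%C
    by ring.
  eapply Rle_trans; [apply Cmod_triangle|]. rewrite Cmod_mult.
  assert (T1 : eps / (2 * (Cmod lg + 1)) * Cmod (g w - g z) <= eps / 2 * Cmod (w - z)).
  { replace (eps / 2 * Cmod (w - z))
      with (eps / (2 * (Cmod lg + 1)) * ((Cmod lg + 1) * Cmod (w - z))) by (field; lra).
    apply Rmult_le_compat_l; [|assumption]. left; apply Rdiv_lt_0_compat; lra. }
  assert (T2 : Cmod lf * Cmod (g w - g z - lg * (w - z)) <= eps / 2 * Cmod (w - z)).
  { apply Rle_trans with ((Cmod lf + 1) * (eps / (2 * (Cmod lf + 1)) * Cmod (w - z))).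
    - apply Rmult_le_compat; auto using Cmod_ge_0; lra.
    - right; field; lra. }
  lra.
Qed.

Lemma cderiv_ext (f g : C -> C) (z l : C) (d : R) : 0 < d ->
  (forall w, Cmod (w - z) < d -> f w = g w) -> cderiv f z l -> cderiv g z l.
Proof.
  intros Hd He Hf eps Hp. destruct (Hf eps Hp) as [d1 [Hd1 H1]].
  exists (Rmin d d1); split; [apply Rmin_pos; assumption|]. intros w Hw.
  pose proof (Rmin_l d d1); pose proof (Rmin_r d d1).
  rewrite <- !He; [apply H1; lra| |lra].
  replace (z - z)%C with (RtoC 0) by ring. rewrite Cmod_0; assumption.
Qed.

Lemma cderiv_eq (f : C -> C) (z l l' : C) : cderiv f z l -> l = l' -> cderiv f z l'.
Proof. intros H <-; exact H. Qed.

Lemma cderiv_inv_id (z : C) : z <> 0 -> cderiv (fun w => / w)%C z (- / (z * z)).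
Proof.
  intros Hz eps He. apply Cmod_gt_0 in Hz as Hm.
  (* The first bound gives |w| >= |z|/2; the error factor |w - z| / (|w| |z|^2) is then at most 2 |w
     - z| / |z|^3, which the second bound makes at most eps. *)
  exists (Rmin (Cmod z / 2) (eps * Cmod z ^ 3 / 2)). split.
  { apply Rmin_pos; [lra|]. pose proof (pow_lt _ 3 Hm). nra. }
  intros w Hw. pose proof (Rmin_l (Cmod z / 2) (eps * Cmod z ^ 3 / 2)).
  pose proof (Rmin_r (Cmod z / 2) (eps * Cmod z ^ 3 / 2)).
  assert (Hwm : Cmod z / 2 <= Cmod w).
  { pose proof (Cmod_triangle_inv z w). rewrite Cmod_sub_sym in H1. lra. }
  assert (Hw0 : w <> 0) by (apply Cmod_gt_0; lra).
  replace (/ w - / z - - / (z * z) * (w - z))%C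
    with ((w - z) * ((w - z) / (w * (z * z))))%C by (field; split; assumption).
  rewrite Cmod_mult, Rmult_comm. apply Rmult_le_compat_r; [apply Cmod_ge_0|].
  rewrite Cmod_div, !Cmod_mult.
  2:{ repeat apply Cmult_neq_0; assumption. }
  apply Rle_div_l; [repeat apply Rmult_lt_0_compat; lra|].
  apply Rle_trans with (eps * Cmod z ^ 3 / 2); [lra|].
  simpl. assert (0 <= Cmod z * Cmod z * eps * (Cmod w - Cmod z / 2)); [|nra].
  apply Rmult_le_pos; [|lra]. apply Rmult_le_pos; [nra|lra].
Qed.

Lemma cderiv_inv (f : C -> C) (z l : C) : f z <> 0 -> cderiv f z l ->
  cderiv (fun w => / f w)%C z (- l / (f z * f z)).
Proof.
  intros Hz Hf. eapply cderiv_eq.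
  - apply (cderiv_comp (fun w => / w)%C f z); [apply cderiv_inv_id, Hz|exact Hf].
  - field; assumption.
Qed.

Lemma cderiv_minus (f g : C -> C) (z lf lg : C) :
  cderiv f z lf -> cderiv g z lg -> cderiv (fun w => f w - g w)%C z (lf - lg).
Proof.
  intros Hf Hg. apply cderiv_plus; [exact Hf|].
  eapply cderiv_eq; [apply (cderiv_comp (fun w => - w)%C g z (-(1)) lg); [|exact Hg]|ring].
  intros eps He; exists 1; split; [lra|]; intros w _.
  replace (- w - - g z - - (1) * (w - g z))%C with (RtoC 0) by ring.
  rewrite Cmod_0. pose proof (Cmod_ge_0 (w - g z)); nra.
Qed.

Lemma cderiv_div (f g : C -> C) (z lf lg : C) : g z <> 0 ->
  cderiv f z lf -> cderiv g z lg ->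
  cderiv (fun w => f w / g w)%C z ((lf * g z - f z * lg) / (g z * g z)).
Proof.
  intros Hz Hf Hg. eapply cderiv_eq.
  - apply cderiv_mult; [exact Hf|apply cderiv_inv; [exact Hz|exact Hg]].
  - simpl. field; assumption.
Qed.

Lemma cderiv_unique (f : C -> C) (z l l' : C) :
  cderiv f z l -> cderiv f z l' -> l = l'.
Proof.
  intros H1 H2. apply Ceq_minus. apply Cmod_eq_0.
  apply Rle_antisym; [|apply Cmod_ge_0]. apply Rnot_lt_le; intros Hp.
  destruct (H1 (Cmod (l - l') / 4)) as [d1 [Hd1 K1]]; [lra|].
  destruct (H2 (Cmod (l - l') / 4)) as [d2 [Hd2 K2]]; [lra|].
  pose proof (Rmin_l d1 d2); pose proof (Rmin_r d1 d2).
  assert (Hm : 0 < Rmin d1 d2) by (apply Rmin_pos; assumption).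
  set (h := Rmin d1 d2 / 2).
  assert (Hh : Cmod (z + RtoC h - z) = h).
  { replace (z + RtoC h - z)%C with (RtoC h) by ring.
    rewrite Cmod_R, Rabs_pos_eq; unfold h; lra. }
  specialize (K1 (z + RtoC h)%C). specialize (K2 (z + RtoC h)%C).
  rewrite Hh in K1, K2. unfold h in K1 at 1; unfold h in K2 at 1.
  specialize (K1 ltac:(lra)). specialize (K2 ltac:(lra)).
  pose proof (Cmod_sub_triangle (f (z + RtoC h) - f z - l' * (z + RtoC h - z))
               (f (z + RtoC h) - f z - l * (z + RtoC h - z)))%C as T.
  replace (f (z + RtoC h) - f z - l' * (z + RtoC h - z)
           - (f (z + RtoC h) - f z - l * (z + RtoC h - z)))%C
    with ((l - l') * (z + RtoC h - z))%C in T by ring.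
  rewrite Cmod_mult, Hh in T. assert (0 < h) by (unfold h; lra). nra.
Qed.

Lemma re_minus (a b : C) : Re (a - b) = Re a - Re b.
Proof. unfold Cminus; rewrite re_plus, re_opp; lra. Qed.

Lemma Re_le_Cmod (z : C) : Re z <= Cmod z.
Proof. eapply Rle_trans; [apply Rle_abs|apply re_le_Cmod]. Qed.

(* A unimodular factor turns bounds on real parts into bounds on the modulus. *)
Lemma exists_phase (z : C) : exists c : C, Cmod c = 1 /\ Re (c * z) = Cmod z.
Proof.
  destruct (Ceq_dec z 0) as [->|Hz].
  - exists 1. rewrite Cmod_1, Cmod_0. split; [reflexivity|]. simpl; lra.
  - apply Cmod_gt_0 in Hz as Hm. exists (Cconj z / RtoC (Cmod z))%C.
    assert (RtoC (Cmod z) <> 0) by (intros E; apply RtoC_inj in E; lra).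
    split.
    + rewrite Cmod_div, Cmod_conj, Cmod_R, Rabs_pos_eq by (assumption || lra). field; lra.
    + replace (Cconj z / RtoC (Cmod z) * z)%C with (RtoC (Cmod z)).
      * apply re_RtoC.
      * replace (Cconj z / RtoC (Cmod z) * z)%C with ((z * Cconj z) / RtoC (Cmod z))%C
          by (field; assumption).
        rewrite <- Cmod2_conj. rewrite RtoC_pow. field; assumption.
Qed.

(** Restriction to a line and to one real direction makes real calculus available: c serves as a
    phase, or as 1 and [- Ci] to read off real and imaginary parts. *)
Lemma cderiv_is_derive_re (f : C -> C) (a h l c : C) (t : R) :
  cderiv f (a + RtoC t * h)%C l ->
  is_derive (fun s => Re (c * f (a + RtoC s * h)%C)) t (Re (c * (l * h))).
Proof.
  intros Hf. apply is_derive_Reals. intros eps He.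
  pose proof (Cmod_ge_0 c); pose proof (Cmod_ge_0 h).
  destruct (Hf (eps / 2 / (Cmod c * Cmod h + 1))) as [d [Hd H1]].
  { apply Rdiv_lt_0_compat; nra. }
  assert (Hd' : 0 < d / (Cmod h + 1)) by (apply Rdiv_lt_0_compat; lra).
  exists (mkposreal _ Hd'). intros s Hs0 Hs. change (Rabs s < d / (Cmod h + 1)) in Hs.
  assert (E : Cmod (a + RtoC (t + s) * h - (a + RtoC t * h)) = Rabs s * Cmod h).
  { replace (a + RtoC (t + s) * h - (a + RtoC t * h))%C with (RtoC s * h)%C
      by (rewrite RtoC_plus; ring).
    rewrite Cmod_mult, Cmod_R; reflexivity. }
  specialize (H1 (a + RtoC (t + s) * h)%C). rewrite E in H1.
  assert (Hs1 : Rabs s * (Cmod h + 1) < d) by (apply Rlt_div_r in Hs; lra).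
  pose proof (Rabs_pos_lt _ Hs0). specialize (H1 ltac:(nra)).
  set (X := (f (a + RtoC (t + s) * h) - f (a + RtoC t * h)
            - l * (a + RtoC (t + s) * h - (a + RtoC t * h)))%C) in *.
  match goal with |- Rabs ?e < _ => replace e with (Re (c * X) * / s) end.
  2:{ unfold X. replace (a + RtoC (t + s) * h - (a + RtoC t * h))%C with (RtoC s * h)%C
        by (rewrite RtoC_plus; ring).
      replace (c * (f (a + RtoC (t + s) * h) - f (a + RtoC t * h) - l * (RtoC s * h)))%C
        with (c * f (a + RtoC (t + s) * h) - c * f (a + RtoC t * h) - RtoC s * (c * (l * h)))%C
        by ring.
      rewrite !re_minus, re_scal_l. field; assumption. }
  rewrite Rabs_mult, Rabs_inv.
  apply Rlt_div_l; [assumption|].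
  eapply Rle_lt_trans; [apply re_le_Cmod|]. rewrite Cmod_mult.
  apply Rle_lt_trans with (Cmod c * (eps / 2 / (Cmod c * Cmod h + 1) * (Rabs s * Cmod h))).
  { apply Rmult_le_compat_l; assumption. }
  replace (Cmod c * (eps / 2 / (Cmod c * Cmod h + 1) * (Rabs s * Cmod h)))
    with (eps * Rabs s * (/2 * ((Cmod c * Cmod h) / (Cmod c * Cmod h + 1)))) by (field; nra).
  rewrite <- (Rmult_1_r (eps * Rabs s)) at 2. apply Rmult_lt_compat_l; [nra|].
  assert ((Cmod c * Cmod h) / (Cmod c * Cmod h + 1) <= 1); [|lra].
  apply Rle_div_l; nra.
Qed.

(** There is no mean value equality for complex values; with c a phase turning f b - f a into its
    modulus, the real one for Re (c f) along the segment is enough. *)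
Lemma cderiv_mean_value (f df : C -> C) (a b : C) (K : R) :
  (forall t, 0 <= t <= 1 ->
     cderiv f (a + RtoC t * (b - a))%C (df (a + RtoC t * (b - a))%C)
     /\ Cmod (df (a + RtoC t * (b - a))%C) <= K) ->
  Cmod (f b - f a) <= K * Cmod (b - a).
Proof.
  intros H. destruct (exists_phase (f b - f a)) as [c [Hc Hr]].
  rewrite <- Hr.
  destruct (MVT_gen (fun t => Re (c * f (a + RtoC t * (b - a))%C)) 0 1
             (fun t => Re (c * (df (a + RtoC t * (b - a))%C * (b - a)))))
    as [t [Ht E]].
  - intros t Ht. rewrite Rmin_left, Rmax_right in Ht by lra.
    apply cderiv_is_derive_re. apply H; lra.
  - intros t Ht. rewrite Rmin_left, Rmax_right in Ht by lra.
    apply continuity_pt_filterlim.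
    apply (ex_derive_continuous (fun s => Re (c * f (a + RtoC s * (b - a))%C)) t).
    eexists. apply cderiv_is_derive_re. apply H; lra.
  - rewrite Rmin_left, Rmax_right in Ht by lra.
    replace (a + RtoC 1 * (b - a))%C with b in E by ring.
    replace (a + RtoC 0 * (b - a))%C with a in E by ring.
    replace (c * (f b - f a))%C with (c * f b - c * f a)%C by ring.
    rewrite re_minus, E, Rminus_0_r, Rmult_1_r.
    eapply Rle_trans; [apply Re_le_Cmod|].
    rewrite !Cmod_mult, Hc, Rmult_1_l. apply Rmult_le_compat_r; [apply Cmod_ge_0|].
    apply H; assumption.
Qed.

(** * Goursat's lemma and the mean value bound *)

(* Goursat's argument: a subadditive function of rectangles that is locally
   negligible against the area vanishes. Rectangles have corner (x, y) and
   sides s * w and s * h. *)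
Lemma quadrisection (E : R -> R -> R -> R) (x0 y0 w h : R) :
  0 < w -> 0 < h ->
  (forall x y s, 0 < s -> x0 <= x -> x + s * w <= x0 + w ->
     y0 <= y -> y + s * h <= y0 + h ->
     E x y s <= E x y (s / 2) + E (x + s / 2 * w) y (s / 2)
       + E x (y + s / 2 * h) (s / 2) + E (x + s / 2 * w) (y + s / 2 * h) (s / 2)) ->
  (forall p q, x0 <= p <= x0 + w -> y0 <= q <= y0 + h ->
     forall eps, 0 < eps -> exists d, 0 < d /\ forall x y s, 0 < s < d ->
       x0 <= x -> x + s * w <= x0 + w -> y0 <= y -> y + s * h <= y0 + h ->
       x <= p <= x + s * w -> y <= q <= y + s * h -> E x y s <= eps * s ^ 2) ->
  E x0 y0 1 <= 0.
Proof.
  intros Hw Hh Hsub Hloc. apply Rnot_lt_le. intros Hpos.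
  set (e := E x0 y0 1 / 2).
  (* Invariant of the subdivision: the value exceeds e times the squared scale. Since 4 (s/2)^2 =
     s^2, it passes to at least one quarter; e is half the initial value, so it holds strictly at
     the start. *)
  set (good := fun (n : nat) (z : R * R) =>
     e * ((/2) ^ n) ^ 2 < E (fst z) (snd z) ((/2) ^ n)
     /\ x0 <= fst z /\ fst z + (/2) ^ n * w <= x0 + w
     /\ y0 <= snd z /\ snd z + (/2) ^ n * h <= y0 + h).
  assert (Hs : forall n, 0 < (/2) ^ n) by (intros; apply pow_lt; lra).
  assert (step : forall n z, good n z -> exists z', good (S n) z' /\
     fst z <= fst z' <= fst z + (/2) ^ n / 2 * w /\
     snd z <= snd z' <= snd z + (/2) ^ n / 2 * h).
  { intros n [x y] [G1 [G2 [G3 [G4 G5]]]]; simpl fst in *; simpl snd in *.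
    pose proof (Hs n) as Hn. set (s := (/2) ^ n) in *.
    specialize (Hsub x y s Hn G2 G3 G4 G5).
    assert (ES : (/2) ^ (S n) = s / 2) by (simpl; unfold s; lra).
    unfold good. rewrite ES. fold s.
    assert (0 < s * w) by nra. assert (0 < s * h) by nra.
    destruct (Rlt_dec (e * (s / 2) ^ 2) (E x y (s / 2))).
    { exists (x, y); simpl fst; simpl snd; repeat split; try assumption; nra. }
    destruct (Rlt_dec (e * (s / 2) ^ 2) (E (x + s / 2 * w) y (s / 2))).
    { exists (x + s / 2 * w, y); simpl fst; simpl snd; repeat split; try assumption; nra. }
    destruct (Rlt_dec (e * (s / 2) ^ 2) (E x (y + s / 2 * h) (s / 2))).
    { exists (x, y + s / 2 * h); simpl fst; simpl snd; repeat split; try assumption; nra. }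
    destruct (Rlt_dec (e * (s / 2) ^ 2) (E (x + s / 2 * w) (y + s / 2 * h) (s / 2))).
    { exists (x + s / 2 * w, y + s / 2 * h); simpl fst; simpl snd;
        repeat split; try assumption; nra. }
    exfalso. nra. }
  assert (base : good O (x0, y0)).
  { unfold good; simpl. unfold e. repeat split; lra. }
  set (next := fun n (zz : {z | good n z}) =>
     let H := constructive_indefinite_description _ (step n (proj1_sig zz) (proj2_sig zz)) in
     exist (good (S n)) (proj1_sig H) (proj1 (proj2_sig H))).
  set (u := fix u n : {z | good n z} :=
     match n with O => exist _ (x0, y0) base | S k => next k (u k) end).
  assert (Hu : forall n, let z := proj1_sig (u n) in let z' := proj1_sig (u (S n)) in
     fst z <= fst z' <= fst z + (/2) ^ n / 2 * w /\
     snd z <= snd z' <= snd z + (/2) ^ n / 2 * h).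
  { intros n. simpl.
    destruct (constructive_indefinite_description _ _) as [z' [G1 G2]]. simpl. exact G2. }
  assert (Hg : forall n, good n (proj1_sig (u n))) by (intros n; apply (proj2_sig (u n))).
  set (X := fun n => fst (proj1_sig (u n))). set (Y := fun n => snd (proj1_sig (u n))).
  (* Nested intervals: left ends do not decrease and right ends do not increase, so the supremum of
     the left ends lies in all of them. *)
  assert (nested : forall (Z : nat -> R) (k : R), 0 < k ->
     (forall n, Z n <= Z (S n) <= Z n + (/2) ^ n / 2 * k) ->
     exists p, forall n, Z n <= p <= Z n + (/2) ^ n * k).
  { intros Z k Hk HZ.
    assert (M1 : forall n m, Z n <= Z (n + m)%nat).
    { intros n m; induction m; [rewrite Nat.add_0_r; lra|].
      rewrite Nat.add_succ_r. specialize (HZ (n + m)%nat); lra. }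
    assert (M2 : forall n m, Z (n + m)%nat + (/2) ^ (n + m) * k <= Z n + (/2) ^ n * k).
    { intros n m; induction m; [rewrite Nat.add_0_r; lra|].
      rewrite Nat.add_succ_r. specialize (HZ (n + m)%nat). simpl.
      pose proof (Hs (n + m)%nat). nra. }
    assert (M3 : forall n m, Z m <= Z n + (/2) ^ n * k).
    { intros n m. destruct (Nat.le_ge_cases n m) as [L|L].
      - replace m with (n + (m - n))%nat by (rewrite Nat.add_comm; apply Nat.sub_add, L).
        specialize (M2 n (m - n)%nat). pose proof (Hs (n + (m - n))%nat). nra.
      - replace n with (m + (n - m))%nat by (rewrite Nat.add_comm; apply Nat.sub_add, L).
        specialize (M1 m (n - m)%nat). pose proof (Hs (m + (n - m))%nat). nra. }
    destruct (completeness (fun r => exists n, r = Z n)) as [p [P1 P2]].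
    - exists (Z O + (/2) ^ 0 * k). intros r [n ->]. apply M3.
    - exists (Z O), O; reflexivity.
    - exists p. intros n; split; [apply P1; exists n; reflexivity|].
      apply P2. intros r [m ->]. apply M3. }
  destruct (nested X w Hw) as [p Hp]; [intros n; apply (Hu n)|].
  destruct (nested Y h Hh) as [q Hq]; [intros n; apply (Hu n)|].
  assert (He : 0 < e) by (unfold e; lra).
  destruct (Hloc p q) with (eps := e) as [d [Hd H]]; try assumption.
  { specialize (Hp O); destruct (Hg O) as [_ [? [? _]]]; fold (X O) in *; simpl in *; lra. }
  { specialize (Hq O); destruct (Hg O) as [_ [_ [_ [? ?]]]]; fold (Y O) in *; simpl in *; lra. }
  destruct (pow_lt_1_zero (/2)) with (y := d) as [N HN].
  { rewrite Rabs_pos_eq; lra. } { assumption. }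
  specialize (HN N (le_n N)). rewrite Rabs_pos_eq in HN by (left; apply Hs).
  destruct (Hg N) as [G1 [G2 [G3 [G4 G5]]]]. fold (X N) in *; fold (Y N) in *.
  specialize (H (X N) (Y N) ((/2) ^ N) (conj (Hs N) HN) G2 G3 G4 G5 (Hp N) (Hq N)). lra.
Qed.

Lemma RInt_near_const (f : R -> R) (a b k eta : R) : a <= b -> ex_RInt f a b ->
  (forall t, a <= t <= b -> Rabs (f t - k) <= eta) ->
  Rabs (RInt f a b - k * (b - a)) <= eta * (b - a).
Proof.
  intros Hab Hf H.
  assert (E1 : RInt (fun _ => k - eta) a b <= RInt f a b).
  { apply RInt_le; auto; [apply ex_RInt_const|]. intros t Ht.
    assert (Ht' : a <= t <= b) by lra. specialize (H t Ht'). apply Rabs_le_between in H. lra. }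
  assert (E2 : RInt f a b <= RInt (fun _ => k + eta) a b).
  { apply RInt_le; auto; [apply ex_RInt_const|]. intros t Ht.
    assert (Ht' : a <= t <= b) by lra. specialize (H t Ht'). apply Rabs_le_between in H. lra. }
  rewrite RInt_const in E1, E2. unfold scal in *; simpl in *; unfold mult in *; simpl in *.
  apply Rabs_le; lra.
Qed.

Lemma diff2_slice1 (P : R -> R -> R) (x y lx ly : R) :
  differentiable_pt_lim P x y lx ly -> continuous (fun t => P t y) x.
Proof.
  intros H. apply (ex_derive_continuous (fun t => P t y)).
  exists (lx * 1 + ly * 0). apply is_derive_Reals.
  apply (derivable_pt_lim_comp_2d P (fun t => t) (fun _ => y)); [exact H| |].
  - apply derivable_pt_lim_id. - apply derivable_pt_lim_const.
Qed.

Lemma diff2_slice2 (P : R -> R -> R) (x y lx ly : R) :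
  differentiable_pt_lim P x y lx ly -> continuous (fun t => P x t) y.
Proof.
  intros H. apply (ex_derive_continuous (fun t => P x t)).
  exists (lx * 0 + ly * 1). apply is_derive_Reals.
  apply (derivable_pt_lim_comp_2d P (fun _ => x) (fun t => t)); [exact H| |].
  - apply derivable_pt_lim_const. - apply derivable_pt_lim_id.
Qed.

(* Cauchy-Goursat for a closed form P dx + Q dy; no continuity of the partial
   derivatives is assumed. *)
Lemma goursat (P Q : R -> R -> R) (a b c d : R) : a < b -> c < d ->
  (forall x y, a <= x <= b -> c <= y <= d -> exists px k qy,
     differentiable_pt_lim P x y px k /\ differentiable_pt_lim Q x y k qy) ->
  RInt (fun x => P x c - P x d) a b + RInt (fun y => Q b y - Q a y) c d = 0.
Proof.
  intros Hab Hcd HPQ.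
  set (w := b - a). set (h := d - c).
  assert (Hw : 0 < w) by (unfold w; lra). assert (Hh : 0 < h) by (unfold h; lra).
  set (circ := fun a b c d =>
    RInt (fun x => P x c - P x d) a b + RInt (fun y => Q b y - Q a y) c d).
  assert (IP : forall y u v, c <= y <= d -> a <= u <= v -> v <= b -> ex_RInt (fun x => P x y) u v).
  { intros y u v Hy Hu Hv. apply (ex_RInt_continuous (V := R_CompleteNormedModule)). intros z Hz.
    rewrite Rmin_left, Rmax_right in Hz by lra.
    destruct (HPQ z y) as [px [k [qy [H1 H2]]]]; [lra|lra|]. eapply diff2_slice1; exact H1. }
  assert (IQ : forall x u v, a <= x <= b -> c <= u <= v -> v <= d -> ex_RInt (fun y => Q x y) u v).
  { intros x u v Hx Hu Hv. apply (ex_RInt_continuous (V := R_CompleteNormedModule)). intros z Hz.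
    rewrite Rmin_left, Rmax_right in Hz by lra.
    destruct (HPQ x z) as [px [k [qy [H1 H2]]]]; [lra|lra|]. eapply diff2_slice2; exact H2. }
  assert (SP : forall y y' u v, c <= y <= d -> c <= y' <= d -> a <= u <= v -> v <= b ->
     RInt (fun x => P x y - P x y') u v = RInt (fun x => P x y) u v - RInt (fun x => P x y') u v).
  { intros. apply (RInt_minus (V := R_CompleteNormedModule)); apply IP; assumption. }
  assert (SQ : forall x x' u v, a <= x <= b -> a <= x' <= b -> c <= u <= v -> v <= d ->
     RInt (fun y => Q x y - Q x' y) u v = RInt (fun y => Q x y) u v - RInt (fun y => Q x' y) u v).
  { intros. apply (RInt_minus (V := R_CompleteNormedModule)); apply IQ; assumption. }
  assert (CP : forall y u v t, c <= y <= d -> a <= u <= v -> v <= t <= b ->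
     RInt (fun x => P x y) u t = RInt (fun x => P x y) u v + RInt (fun x => P x y) v t).
  { intros. symmetry. apply (RInt_Chasles (V := R_CompleteNormedModule)); apply IP; lra. }
  assert (CQ : forall x u v t, a <= x <= b -> c <= u <= v -> v <= t <= d ->
     RInt (fun y => Q x y) u t = RInt (fun y => Q x y) u v + RInt (fun y => Q x y) v t).
  { intros. symmetry. apply (RInt_Chasles (V := R_CompleteNormedModule)); apply IQ; lra. }
  change (circ a b c d = 0).
  apply Rabs_eq_0, Rle_antisym; [|apply Rabs_pos].
  pose proof (quadrisection
    (fun x y s => Rabs (circ x (x + s * w) y (y + s * h))) a c w h Hw Hh) as Qd.
  replace (circ a b c d) with (circ a (a + 1 * w) c (c + 1 * h))
    by (f_equal; unfold w, h; lra).
  apply Qd; clear Qd.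
  - intros x y s Hs X1 X2 Y1 Y2.
    assert (0 < s * w) by nra. assert (0 < s * h) by nra.
    replace (x + s / 2 * w + s / 2 * w) with (x + s * w) by lra.
    replace (y + s / 2 * h + s / 2 * h) with (y + s * h) by lra.
    set (xm := x + s / 2 * w). set (ym := y + s / 2 * h).
    assert (x < xm < x + s * w) by (unfold xm; nra).
    assert (y < ym < y + s * h) by (unfold ym; nra).
    set (x' := x + s * w) in *. set (y' := y + s * h) in *.
    assert (x' <= b) by (unfold w in X2; lra). assert (y' <= d) by (unfold h in Y2; lra).
    replace (circ x x' y y') with
      (circ x xm y ym + circ xm x' y ym + circ x xm ym y' + circ xm x' ym y').
    { eapply Rle_trans; [apply Rabs_triang|]. apply Rplus_le_compat_r.
      eapply Rle_trans; [apply Rabs_triang|]. apply Rplus_le_compat_r. apply Rabs_triang. }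
    unfold circ. rewrite !SP, !SQ by lra.
    rewrite (CP y x xm x'), (CP y' x xm x'), (CQ x' y ym y'), (CQ x y ym y') by lra. ring.
  - intros p q Hp Hq eps He.
    destruct (HPQ p q) as [px [k [qy [DP DQ]]]]; [unfold w in Hp; lra|unfold h in Hq; lra|].
    (* The linearization error, at most (eps / K) s (w + h) at each point, enters twice in each
       integrand, over total length s (w + h); this K makes the sum exactly eps s^2. *)
    set (K := (w + h) * 2 * (w + h)).
    assert (HK : 0 < K) by (unfold K; nra).
    assert (He' : 0 < eps / K) by (apply Rdiv_lt_0_compat; assumption).
    destruct (DP (mkposreal _ He')) as [d1 D1]. destruct (DQ (mkposreal _ He')) as [d2 D2].
    simpl in D1, D2.
    pose proof (cond_pos d1); pose proof (cond_pos d2).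
    exists (Rmin d1 d2 / (w + h)). split.
    { apply Rdiv_lt_0_compat; [apply Rmin_pos; assumption|lra]. }
    intros x y s [Hs Hsd] X1 X2 Y1 Y2 Xp Yq.
    apply Rlt_div_r in Hsd; [|lra].
    pose proof (Rmin_l d1 d2); pose proof (Rmin_r d1 d2).
    assert (0 < s * w) by nra. assert (0 < s * h) by nra.
    set (x' := x + s * w) in *. set (y' := y + s * h) in *.
    assert (x' <= b) by (unfold w in X2; lra). assert (y' <= d) by (unfold h in Y2; lra).
    assert (near : forall u v, x <= u <= x' -> y <= v <= y' ->
      Rabs (u - p) < Rmin d1 d2 /\ Rabs (v - q) < Rmin d1 d2 /\
      Rmax (Rabs (u - p)) (Rabs (v - q)) <= s * (w + h)).
    { intros u v Hu Hv.
      assert (Rabs (u - p) <= s * w) by (apply Rabs_le; unfold x' in *; lra).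
      assert (Rabs (v - q) <= s * h) by (apply Rabs_le; unfold y' in *; lra).
      repeat split; [nra|nra|]. apply Rmax_lub; nra. }
    assert (LP : forall u v, x <= u <= x' -> y <= v <= y' ->
      Rabs (P u v - P p q - (px * (u - p) + k * (v - q))) <= eps / K * (s * (w + h))).
    { intros u v Hu Hv. destruct (near u v Hu Hv) as [N1 [N2 N3]].
      eapply Rle_trans; [apply D1; lra|]. apply Rmult_le_compat_l; lra. }
    assert (LQ : forall u v, x <= u <= x' -> y <= v <= y' ->
      Rabs (Q u v - Q p q - (k * (u - p) + qy * (v - q))) <= eps / K * (s * (w + h))).
    { intros u v Hu Hv. destruct (near u v Hu Hv) as [N1 [N2 N3]].
      eapply Rle_trans; [apply D2; lra|]. apply Rmult_le_compat_l; lra. }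
    set (eta := eps / K * (s * (w + h))) in *.
    (* After linearization only cross terms survive: k (y - y') (x' - x) here and its negative from
       Q, because P and Q share the mixed coefficient k. This is where closedness enters. *)
    assert (B1 : Rabs (RInt (fun u => P u y - P u y') x x' - k * (y - y') * (x' - x))
                 <= 2 * eta * (x' - x)).
    { apply RInt_near_const; [lra| |].
      - apply (ex_RInt_minus (V := R_NormedModule) (fun u => P u y) (fun u => P u y')); apply IP; lra.
      - intros t Ht. pose proof (LP t y Ht ltac:(lra)) as A1. pose proof (LP t y' Ht ltac:(lra)) as A2.
        apply Rabs_le_between in A1, A2. apply Rabs_le. lra. }
    assert (B2 : Rabs (RInt (fun v => Q x' v - Q x v) y y' - k * (x' - x) * (y' - y))
                 <= 2 * eta * (y' - y)).
    { apply RInt_near_const; [lra| |].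
      - apply (ex_RInt_minus (V := R_NormedModule) (fun v => Q x' v) (fun v => Q x v)); apply IQ; lra.
      - intros t Ht. pose proof (LQ x t ltac:(lra) Ht) as A1. pose proof (LQ x' t ltac:(lra) Ht) as A2.
        apply Rabs_le_between in A1, A2. apply Rabs_le. lra. }
    unfold circ. apply Rabs_le_between in B1, B2.
    assert (EQ : 2 * eta * (x' - x) + 2 * eta * (y' - y) = eps * s ^ 2).
    { unfold eta, x', y', K. field. lra. }
    apply Rabs_le. lra.
Qed.

(** * Circle means in polar coordinates *)

Lemma diff2_mult (f g : R -> R -> R) (x y fx fy gx gy : R) :
  differentiable_pt_lim f x y fx fy -> differentiable_pt_lim g x y gx gy ->
  differentiable_pt_lim (fun u v => f u v * g u v) x y
    (g x y * fx + f x y * gx) (g x y * fy + f x y * gy).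
Proof.
  intros Hf Hg. apply (differentiable_pt_lim_comp Rmult f g); try assumption.
  intros eps. exists eps. intros u v Hu Hv.
  replace (u * v - f x y * g x y - (g x y * (u - f x y) + f x y * (v - g x y)))
    with ((u - f x y) * (v - g x y)) by ring.
  rewrite Rabs_mult.
  apply Rmult_le_compat; try apply Rabs_pos; [lra|apply Rmax_r].
Qed.

Lemma diff2_of_snd (f : R -> R) (x y l : R) : derivable_pt_lim f y l ->
  differentiable_pt_lim (fun _ v => f v) x y 0 l.
Proof.
  intros H eps.
  destruct (differentiable_pt_lim_proj1_0 f y x l H eps) as [d D].
  exists d. intros u v Hu Hv. specialize (D v u Hv Hu). rewrite Rmax_comm.
  replace (f v - f y - (0 * (u - x) + l * (v - y)))
    with (f v - f y - (l * (v - y) + 0 * (u - x))) by ring. exact D.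
Qed.

(** The Cauchy-Riemann equations as a total differential: partial derivatives alone would not
    survive the substitution of polar coordinates. *)
Lemma cderiv_diff2_re (f : C -> C) (x y : R) (l : C) : cderiv f (x, y) l ->
  differentiable_pt_lim (fun u v => Re (f (u, v))) x y (Re l) (- Im l).
Proof.
  intros Hf eps. pose proof (cond_pos eps) as He.
  destruct (Hf (eps / 2)) as [d [Hd H]]; [lra|].
  assert (Hd2 : 0 < d / 2) by lra. exists (mkposreal _ Hd2). intros u v Hu Hv.
  change (Rabs (u - x) < d / 2) in Hu. change (Rabs (v - y) < d / 2) in Hv.
  assert (B : Cmod ((u, v) - (x, y)) <= 2 * Rmax (Rabs (u - x)) (Rabs (v - y))).
  { eapply Rle_trans; [apply Cmod_2Rmax|]. simpl. apply Rmult_le_compat_r.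
    - eapply Rle_trans; [apply Rabs_pos|apply Rmax_l].
    - pose proof (sqrt_sqrt 2 ltac:(lra)). pose proof (sqrt_pos 2). nra. }
  assert (B' : Rmax (Rabs (u - x)) (Rabs (v - y)) < d / 2) by (apply Rmax_lub_lt; assumption).
  specialize (H (u, v) ltac:(lra)).
  match goal with |- Rabs ?e <= _ =>
    replace e with (Re (f (u, v) - f (x, y) - l * ((u, v) - (x, y)))) end.
  - eapply Rle_trans; [apply re_le_Cmod|]. eapply Rle_trans; [apply H|]. nra.
  - rewrite !re_minus, re_mult. unfold Im, Re; simpl. ring.
Qed.

Lemma cderiv_scal (f : C -> C) (c z l : C) : cderiv f z l ->
  cderiv (fun w => c * f w)%C z (c * l).
Proof.
  intros H. eapply cderiv_eq; [apply cderiv_mult; [apply cderiv_const|exact H]|].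
  simpl; ring.
Qed.

Lemma cderiv_diff2_im (f : C -> C) (x y : R) (l : C) : cderiv f (x, y) l ->
  differentiable_pt_lim (fun u v => Im (f (u, v))) x y (Im l) (Re l).
Proof.
  intros Hf. apply (cderiv_scal f (- Ci)) in Hf. apply cderiv_diff2_re in Hf.
  replace (Re (- Ci * l)) with (Im l) in Hf by (unfold Re, Im; simpl; ring).
  replace (- Im (- Ci * l)) with (Re l) in Hf by (unfold Re, Im; simpl; ring).
  eapply differentiable_pt_lim_ext; [|exact Hf].
  exists (mkposreal 1 Rlt_0_1). intros u v _ _. unfold Re, Im; simpl; ring.
Qed.

Definition cis (t : R) : C := (cos t, sin t).

Lemma Cmod_cis (t : R) : Cmod (cis t) = 1.
Proof.
  unfold Cmod, cis; simpl. rewrite !Rmult_1_r.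
  pose proof (sin2_cos2 t) as H. unfold Rsqr in H.
  replace (cos t * cos t + sin t * sin t) with 1 by lra. apply sqrt_1.
Qed.

Lemma Cmod_scal_cis (r t : R) : 0 <= r -> Cmod (RtoC r * cis t) = r.
Proof. intros H. rewrite Cmod_mult, Cmod_R, Cmod_cis, Rabs_pos_eq by assumption. ring. Qed.

Lemma scal_cis (r t : R) : (RtoC r * cis t)%C = (r * cos t, r * sin t).
Proof. unfold cis, RtoC, Cmult; simpl. f_equal; ring. Qed.

(** In polar coordinates P dr + Q dt is the real part of f dz / (i z), closed because r u_r = v_t
    for f = u + i v. On the rectangle [r1, r2] x [0, 2 pi] the sides t = 0 and t = 2 pi cancel by
    periodicity. The centre is left out, so that removable singularities can be treated. *)
Lemma circle_mean_re_constant (f : C -> C) (rho r1 r2 : R) :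
  (forall z, 0 < Cmod z < rho -> exists l, cderiv f z l) ->
  0 < r1 -> r1 < r2 -> r2 < rho ->
  ex_RInt (fun t => Re (f (RtoC r2 * cis t)%C) - Re (f (RtoC r1 * cis t)%C)) 0 (2 * PI) /\
  RInt (fun t => Re (f (RtoC r2 * cis t)%C) - Re (f (RtoC r1 * cis t)%C)) 0 (2 * PI) = 0.
Proof.
  intros Hf H1 H2 H3. pose proof PI_RGT_0 as Hpi.
  set (Q := fun r t => Re (f (r * cos t, r * sin t))).
  set (P := fun r t => Im (f (r * cos t, r * sin t)) * / r).
  assert (HPQ : forall r t, r1 <= r <= r2 -> exists px k qy,
     differentiable_pt_lim P r t px k /\ differentiable_pt_lim Q r t k qy).
  { intros r t Hr.
    destruct (Hf (RtoC r * cis t)%C) as [l Hl]; [rewrite Cmod_scal_cis; lra|].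
    rewrite scal_cis in Hl.
    assert (Dc : differentiable_pt_lim (fun r t => r * cos t) r t
                   (cos t * 1 + r * 0) (cos t * 0 + r * - sin t)).
    { apply (diff2_mult (fun r _ => r) (fun _ t => cos t)).
      - apply (differentiable_pt_lim_proj1_0 (fun r => r)), derivable_pt_lim_id.
      - apply diff2_of_snd, derivable_pt_lim_cos. }
    assert (Ds : differentiable_pt_lim (fun r t => r * sin t) r t
                   (sin t * 1 + r * 0) (sin t * 0 + r * cos t)).
    { apply (diff2_mult (fun r _ => r) (fun _ t => sin t)).
      - apply (differentiable_pt_lim_proj1_0 (fun r => r)), derivable_pt_lim_id.
      - apply diff2_of_snd, derivable_pt_lim_sin. }
    assert (Di : differentiable_pt_lim (fun r _ : R => / r) r t (- / (r * r)) 0).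
    { apply (differentiable_pt_lim_proj1_0 (fun r => / r)). apply is_derive_Reals.
      auto_derive; [lra|field; lra]. }
    pose proof (differentiable_pt_lim_comp _ _ _ _ _ _ _ _ _ _ _
                  (cderiv_diff2_re _ _ _ _ Hl) Dc Ds) as DQ.
    pose proof (differentiable_pt_lim_comp _ _ _ _ _ _ _ _ _ _ _
                  (cderiv_diff2_im _ _ _ _ Hl) Dc Ds) as DI.
    pose proof (diff2_mult _ _ _ _ _ _ _ _ DI Di) as DP. cbv beta in DP, DQ.
    do 3 eexists; split; [exact DP|].
    match type of DQ with differentiable_pt_lim _ _ _ ?k _ =>
      match goal with |- differentiable_pt_lim _ _ _ ?k' _ => replace k' with k end end.
    - exact DQ.
    - field; lra. }
  assert (EQ : forall r t, Re (f (RtoC r * cis t)%C) = Q r t)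
    by (intros r t; unfold Q; rewrite scal_cis; reflexivity).
  split.
  - apply (ex_RInt_minus (V := R_NormedModule) (fun t => Re (f (RtoC r2 * cis t)%C))
            (fun t => Re (f (RtoC r1 * cis t)%C)));
      apply (ex_RInt_continuous (V := R_CompleteNormedModule)); intros z _;
      [destruct (HPQ r2 z ltac:(lra)) as [px [k [qy [_ D]]]]
      |destruct (HPQ r1 z ltac:(lra)) as [px [k [qy [_ D]]]]];
      apply diff2_slice2 in D; eapply continuous_ext; try exact D; intros t; simpl;
      symmetry; apply EQ.
  - pose proof (goursat P Q r1 r2 0 (2 * PI) H2 ltac:(lra)) as G.
    rewrite (RInt_ext _ (fun _ => 0)) in G.
    + rewrite RInt_const in G. unfold scal in G; simpl in G; unfold mult in G; simpl in G.
      rewrite Rmult_0_r, Rplus_0_l in G.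
      etransitivity; [|apply G; intros; apply HPQ; lra]. apply RInt_ext. intros t _.
      rewrite !EQ. reflexivity.
    + intros x _. unfold P. rewrite cos_2PI, sin_2PI, cos_0, sin_0. simpl. ring.
Qed.

(** If |f 0| > M, then, up to a phase, the real part on a small circle exceeds that on the circle of
    radius r by a fixed amount, although both means agree. At 0 continuity is all that is asked, so
    f may be a difference quotient extended by its limit. *)
Lemma centre_bound (f : C -> C) (rho r M : R) :
  (forall z, 0 < Cmod z < rho -> exists l, cderiv f z l) ->
  (forall eps, 0 < eps -> exists d, 0 < d /\
     forall z, Cmod z < d -> Cmod (f z - f 0) < eps) ->
  0 < r < rho -> (forall z, Cmod z = r -> Cmod (f z) <= M) -> Cmod (f 0) <= M.
Proof.
  intros Hf Hc [Hr1 Hr2] HM. apply Rnot_lt_le; intros Hlt.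
  destruct (exists_phase (f 0)) as [c [Hc1 Hc2]].
  set (eps := (Cmod (f 0) - M) / 2).
  assert (He : 0 < eps) by (unfold eps; lra).
  destruct (Hc eps He) as [d [Hd H]].
  set (s := Rmin d r / 2).
  pose proof (Rmin_l d r); pose proof (Rmin_r d r).
  assert (Hmin : 0 < Rmin d r) by (apply Rmin_pos; assumption).
  assert (Hs : 0 < s < d) by (unfold s; lra). assert (Hsr : s < r) by (unfold s; lra).
  destruct (circle_mean_re_constant (fun z => c * f z)%C rho s r) as [I1 I2]; try lra.
  { intros z Hz. destruct (Hf z Hz) as [l Hl]. exists (c * l)%C. apply cderiv_scal, Hl. }
  pose proof PI_RGT_0.
  match type of I2 with ?I = 0 => assert (I < 0); [|lra] end.
  apply Rle_lt_trans with (RInt (fun _ => - eps) 0 (2 * PI)).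
  - apply RInt_le; [lra|assumption|apply ex_RInt_const|]. intros t _.
    assert (A1 : Re (c * f (RtoC r * cis t)%C) <= M).
    { eapply Rle_trans; [apply Re_le_Cmod|]. rewrite Cmod_mult, Hc1, Rmult_1_l.
      apply HM. apply Cmod_scal_cis; lra. }
    assert (A2 : Cmod (f 0) - eps <= Re (c * f (RtoC s * cis t)%C)).
    { pose proof (Re_le_Cmod (c * (f 0 - f (RtoC s * cis t)))%C) as A.
      replace (c * (f 0 - f (RtoC s * cis t)))%C with (c * f 0 - c * f (RtoC s * cis t))%C in A by ring.
      rewrite re_minus, Hc2 in A.
      replace (c * f 0 - c * f (RtoC s * cis t))%C with (c * (f 0 - f (RtoC s * cis t)))%C in A by ring.
      rewrite Cmod_mult, Hc1, Rmult_1_l, Cmod_sub_sym in A.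
      specialize (H (RtoC s * cis t)%C). rewrite Cmod_scal_cis in H by lra.
      specialize (H ltac:(lra)). lra. }
    unfold eps in *. lra.
  - rewrite RInt_const. unfold scal; simpl; unfold mult; simpl. nra.
Qed.

(** * Cauchy estimates, the maximum principle and the Schwarz-Pick lemma *)

Lemma Csub_diag (z : C) : (z - z)%C = 0.
Proof. ring. Qed.

Lemma cderiv_shift (f : C -> C) (h z l : C) : cderiv f (z + h)%C l ->
  cderiv (fun w => f (w + h)%C) z l.
Proof.
  intros H. eapply cderiv_eq.
  - apply (cderiv_comp f (fun w => w + h)%C z l (1 + 0)); [exact H|].
    apply cderiv_plus; [apply cderiv_id|apply cderiv_const].
  - ring.
Qed.

(** This is [centre_bound] for the difference quotient at q, with value l at the centre. On the
    circle of radius rho / 2 the quotient is at most 2 M / (rho / 2), hence the factor 4. *)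
Lemma cauchy_estimate (g : C -> C) (q l : C) (rho M : R) : 0 < rho ->
  (forall z, Cmod (z - q) < rho -> exists l', cderiv g z l') -> cderiv g q l ->
  (forall z, Cmod (z - q) < rho -> Cmod (g z) <= M) -> Cmod l <= 4 * M / rho.
Proof.
  intros Hr Hg Hl HM.
  set (F := fun z : C => if Ceq_dec z 0 then l else ((g (z + q) - g q) / z)%C).
  assert (F0 : F 0 = l) by (unfold F; destruct (Ceq_dec 0 0); congruence).
  rewrite <- F0. apply (centre_bound F rho (rho / 2)); [| | lra|].
  - intros z [Hz1 Hz2]. apply Cmod_gt_0 in Hz1 as Hz0.
    destruct (Hg (z + q)%C) as [l' Hl'].
    { replace (z + q - q)%C with z by ring. exact Hz2. }
    eexists. apply (cderiv_ext (fun z => (g (z + q) - g q) / z)%C F z _ (Cmod z) Hz1).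
    + intros w Hw. unfold F. destruct (Ceq_dec w 0) as [->|]; [|reflexivity].
      exfalso. replace (0 - z)%C with (- z)%C in Hw by ring. rewrite Cmod_opp in Hw. lra.
    + apply cderiv_div; [exact Hz0| |apply cderiv_id].
      apply cderiv_minus; [apply cderiv_shift; exact Hl'|apply cderiv_const].
  - intros eps He. destruct (Hl (eps / 2)) as [d [Hd H]]; [lra|].
    exists d; split; [assumption|]. intros z Hz. rewrite F0. unfold F.
    destruct (Ceq_dec z 0) as [E|E].
    + rewrite Csub_diag, Cmod_0. assumption.
    + apply Cmod_gt_0 in E as Hm.
      specialize (H (z + q)%C). replace (z + q - q)%C with z in H by ring.
      specialize (H Hz).
      replace ((g (z + q) - g q) / z - l)%C with ((g (z + q) - g q - l * z) / z)%C
        by (field; assumption).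
      rewrite Cmod_div by assumption. apply Rlt_div_l; [assumption|]. nra.
  - intros z Hz. unfold F. destruct (Ceq_dec z 0) as [->|E].
    { exfalso. rewrite Cmod_0 in Hz. lra. }
    rewrite Cmod_div by assumption. rewrite Hz. apply Rle_div_l; [lra|].
    replace (4 * M / rho * (rho / 2)) with (M + M) by (field; lra).
    eapply Rle_trans; [apply Cmod_sub_triangle|].
    apply Rplus_le_compat; apply HM.
    + replace (z + q - q)%C with z by ring. lra.
    + rewrite Csub_diag, Cmod_0. assumption.
Qed.

Lemma punctured_limit (D : C -> C) (K r : R) : 0 < r ->
  (forall h k, 0 < Cmod h < r -> 0 < Cmod k < r ->
     Cmod (D h - D k) <= K * (Cmod h + Cmod k)) ->
  exists l, forall h, 0 < Cmod h < r -> Cmod (D h - l) <= K * Cmod h.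
Proof.
  intros Hr H.
  (* Real test increments tending to 0; the 2 puts even [x 0] strictly inside the punctured ball. *)
  set (x := fun n : nat => r / (INR n + 2)).
  assert (Hi : forall n, 0 <= INR n) by (intros; apply pos_INR).
  assert (Hx : forall n, 0 < x n < r).
  { intros n. specialize (Hi n). unfold x; split; [apply Rdiv_lt_0_compat; lra|].
    apply Rlt_div_l; nra. }
  assert (Hxm : forall n, Cmod (RtoC (x n)) = x n).
  { intros n. rewrite Cmod_R, Rabs_pos_eq; [reflexivity|]. specialize (Hx n); lra. }
  assert (HK : 0 <= K).
  { specialize (H (RtoC (x O)) (RtoC (x O))). rewrite Hxm in H.
    pose proof (Hx O) as Hx0. specialize (H Hx0 Hx0). rewrite Csub_diag, Cmod_0 in H. nra. }
  assert (Hsmall : forall eps, 0 < eps -> exists N, forall n, (n >= N)%nat -> x n < eps).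
  { intros eps He. destruct (INR_unbounded (r / eps)) as [N HN]. exists N. intros n Hn.
    apply le_INR in Hn. unfold x. specialize (Hi n). apply Rlt_div_l; [lra|].
    apply Rlt_div_l in HN; [|assumption]. nra. }
  assert (Hcau : forall eps, 0 < eps -> exists N, forall n m, (n >= N)%nat -> (m >= N)%nat ->
     Cmod (D (RtoC (x n)) - D (RtoC (x m))) < eps).
  { intros eps He. destruct (Hsmall (eps / (2 * (K + 1)))) as [N HN].
    { apply Rdiv_lt_0_compat; lra. }
    exists N. intros n m Hn Hm. eapply Rle_lt_trans.
    { apply H; rewrite Hxm; apply Hx. }
    rewrite !Hxm. pose proof (HN n Hn) as A1. pose proof (HN m Hm) as A2.
    apply Rlt_div_r in A1; [|lra]. apply Rlt_div_r in A2; [|lra].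
    pose proof (Hx n); pose proof (Hx m). nra. }
  destruct (Rcomplete.R_complete (fun n => Re (D (RtoC (x n))))) as [l1 L1].
  { intros eps He. destruct (Hcau eps He) as [N HN]. exists N. intros n m Hn Hm.
    unfold Rdist. rewrite <- re_minus. eapply Rle_lt_trans; [apply re_le_Cmod|].
    apply HN; assumption. }
  destruct (Rcomplete.R_complete (fun n => Im (D (RtoC (x n))))) as [l2 L2].
  { intros eps He. destruct (Hcau eps He) as [N HN]. exists N. intros n m Hn Hm.
    unfold Rdist. eapply Rle_lt_trans; [|apply (HN n m Hn Hm)].
    eapply Rle_trans; [|apply Rmax_Cmod]. apply Rmax_r. }
  exists (l1, l2). intros h Hh. apply le_epsilon. intros eps He.
  destruct (L1 (eps / 4)) as [N1 HN1]; [lra|]. destruct (L2 (eps / 4)) as [N2 HN2]; [lra|].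
  destruct (Hsmall (eps / (2 * (K + 1)))) as [N3 HN3].
  { apply Rdiv_lt_0_compat; lra. }
  set (n := (N1 + N2 + N3)%nat).
  specialize (HN1 n ltac:(unfold n; lia)). specialize (HN2 n ltac:(unfold n; lia)).
  specialize (HN3 n ltac:(unfold n; lia)). apply Rlt_div_r in HN3; [|lra].
  unfold Rdist in HN1, HN2.
  replace (D h - (l1, l2))%C with ((D h - D (RtoC (x n))) + (D (RtoC (x n)) - (l1, l2)))%C by ring.
  eapply Rle_trans; [apply Cmod_triangle|].
  assert (A1 : Cmod (D h - D (RtoC (x n))) <= K * (Cmod h + x n)).
  { rewrite <- (Hxm n) at 2. apply H; [assumption|]. rewrite Hxm; apply Hx. }
  assert (A2 : Cmod (D (RtoC (x n)) - (l1, l2)) <= eps / 2).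
  { eapply Rle_trans; [apply Cmod_2Rmax|].
    apply Rle_trans with (2 * (eps / 4)); [|lra]. apply Rmult_le_compat.
    - apply sqrt_pos.
    - eapply Rle_trans; [apply Rabs_pos|apply Rmax_l].
    - pose proof (sqrt_sqrt 2 ltac:(lra)). pose proof (sqrt_pos 2). nra.
    - apply Rmax_lub; left; [exact HN1|exact HN2]. }
  pose proof (Hx n). nra.
Qed.

Lemma ball_shift (p z h : C) : Cmod (z + h - p) <= Cmod (z - p) + Cmod h.
Proof. replace (z + h - p)%C with ((z - p) + h)%C by ring. apply Cmod_triangle. Qed.

Lemma ball_triangle (p z w : C) : Cmod (w - p) <= Cmod (w - z) + Cmod (z - p).
Proof. replace (w - p)%C with ((w - z) + (z - p))%C by ring. apply Cmod_triangle. Qed.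

Lemma cderiv_mean_value_add (f df : C -> C) (a h : C) (K : R) :
  (forall t, 0 <= t <= 1 ->
     cderiv f (a + RtoC t * h)%C (df (a + RtoC t * h)%C)
     /\ Cmod (df (a + RtoC t * h)%C) <= K) ->
  Cmod (f (a + h)%C - f a) <= K * Cmod h.
Proof.
  intros H. pose proof (cderiv_mean_value f df a (a + h)%C K) as M.
  replace (a + h - a)%C with h in M by ring. apply M, H.
Qed.

Lemma Cmod_scal_le (t : R) (h : C) : 0 <= t <= 1 -> Cmod (RtoC t * h) <= Cmod h.
Proof.
  intros Ht. rewrite Cmod_mult, Cmod_R, Rabs_pos_eq by lra.
  pose proof (Cmod_ge_0 h). nra.
Qed.

(* The difference quotients of df are the derivatives of those of f, which
   converge uniformly; Cauchy's estimate transfers the convergence. *)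
Lemma cderiv_derivative_ball (f df : C -> C) (p : C) (rho : R) : 0 < rho ->
  (forall z, Cmod (z - p) < 4 * rho -> cderiv f z (df z)) ->
  (forall z, Cmod (z - p) < 4 * rho -> Cmod (f z) <= 1) ->
  exists l, cderiv df p l.
Proof.
  intros Hr Hf Hb.
  (* Each estimate spends a collar: df is bounded within 3 rho of p, its increments of step below
     rho / 2 are controlled within 2 rho, and difference quotients are compared within rho. *)
  assert (L1 : forall q, Cmod (q - p) < 3 * rho -> Cmod (df q) <= 4 / rho).
  { intros q Hq. replace (4 / rho) with (4 * 1 / rho) by lra.
    apply (cauchy_estimate f q); [assumption| | |].
    - intros z Hz. exists (df z). apply Hf. pose proof (ball_triangle p q z); lra.
    - apply Hf; lra.
    - intros z Hz. apply Hb. pose proof (ball_triangle p q z); lra. }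
  assert (Lip : forall z h, Cmod (z - p) + Cmod h < 3 * rho ->
     Cmod (f (z + h)%C - f z) <= 4 / rho * Cmod h).
  { intros z h Hz. apply (cderiv_mean_value_add f df). intros t Ht.
    pose proof (ball_shift p z (RtoC t * h)). pose proof (Cmod_scal_le t h Ht).
    split; [apply Hf; lra|apply L1; lra]. }
  assert (L2 : forall z h, Cmod (z - p) < 2 * rho -> Cmod h < rho / 2 ->
     Cmod (df (z + h)%C - df z) <= 32 / rho ^ 2 * Cmod h).
  { intros z h Hz Hh.
    replace (32 / rho ^ 2 * Cmod h) with (4 * (4 / rho * Cmod h) / (rho / 2)) by (field; lra).
    assert (DD : forall w, Cmod (w - z) < rho / 2 ->
      cderiv (fun w => f (w + h) - f w)%C w (df (w + h)%C - df w)).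
    { intros w Hw. pose proof (ball_triangle p z w). pose proof (ball_shift p w h).
      apply cderiv_minus; [apply cderiv_shift|]; apply Hf; lra. }
    apply (cauchy_estimate (fun w => f (w + h) - f w)%C z); [lra| | |].
    - intros w Hw. eexists. apply DD, Hw.
    - apply DD. rewrite Csub_diag, Cmod_0; lra.
    - intros w Hw. pose proof (ball_triangle p z w). apply Lip; lra. }
  set (K := 32 / rho ^ 2) in *.
  assert (HK : 0 < K) by (unfold K; apply Rdiv_lt_0_compat; [lra|apply pow_lt; assumption]).
  assert (L3 : forall z h, Cmod (z - p) < 2 * rho -> Cmod h < rho / 2 ->
     Cmod (f (z + h)%C - f z - df z * h) <= K * Cmod h * Cmod h).
  { intros z h Hz Hh.
    pose proof (cderiv_mean_value_add (fun w => f w - df z * w)%C (fun w => df w - df z)%C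
                  z h (K * Cmod h)) as MV.
    cbv beta in MV.
    replace (f (z + h) - df z * (z + h) - (f z - df z * z))%C
      with (f (z + h) - f z - df z * h)%C in MV by ring.
    apply MV. intros t Ht.
    pose proof (ball_shift p z (RtoC t * h)). pose proof (Cmod_scal_le t h Ht). split.
    - eapply cderiv_eq.
      + apply cderiv_minus; [apply Hf; lra|apply cderiv_scal, cderiv_id].
      + ring.
    - eapply Rle_trans; [apply L2; lra|]. apply Rmult_le_compat_l; lra. }
  destruct (punctured_limit (fun h => (df (p + h) - df p) / h)%C (4 * K / rho) (rho / 2))
    as [l Hl]; [lra| |].
  { intros h k [Hh0 Hh] [Hk0 Hk]. apply Cmod_gt_0 in Hh0 as Eh. apply Cmod_gt_0 in Hk0 as Ek.
    set (G := fun w => ((f (w + h) - f w) / h - (f (w + k) - f w) / k)%C).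
    replace (4 * K / rho * (Cmod h + Cmod k)) with (4 * (K * (Cmod h + Cmod k)) / rho)
      by (field; lra).
    assert (DG : forall w, Cmod (w - p) < rho ->
      cderiv G w ((df (w + h)%C - df w) / h - (df (w + k)%C - df w) / k)%C).
    { intros w Hw. pose proof (ball_shift p w h). pose proof (ball_shift p w k).
      assert (Q : forall c : C, c <> 0 -> Cmod c < rho ->
        cderiv (fun w => (f (w + c) - f w) / c)%C w ((df (w + c) - df w) / c)%C).
      { intros c Hc Hcr. pose proof (ball_shift p w c).
        eapply cderiv_eq; [apply cderiv_mult; [|apply cderiv_const]|].
        - apply cderiv_minus; [apply cderiv_shift|]; apply Hf; lra.
        - simpl. field; assumption. }
      apply cderiv_minus; apply Q; try assumption; lra. }
    apply (cauchy_estimate G p); [assumption| | |].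
    - intros w Hw. eexists. apply DG, Hw.
    - apply DG. rewrite Csub_diag, Cmod_0; assumption.
    - intros w Hw. unfold G.
      assert (Q : forall c : C, c <> 0 -> Cmod c < rho / 2 ->
        Cmod ((f (w + c) - f w) / c - df w)%C <= K * Cmod c).
      { intros c Hc Hcr. apply Cmod_gt_0 in Hc as Hcm.
        replace ((f (w + c) - f w) / c - df w)%C with ((f (w + c) - f w - df w * c) / c)%C
          by (field; assumption).
        rewrite Cmod_div by assumption. apply Rle_div_l; [assumption|]. apply L3; lra. }
      pose proof (Q h Eh Hh). pose proof (Q k Ek Hk).
      replace ((f (w + h) - f w) / h - (f (w + k) - f w) / k)%C
        with (((f (w + h) - f w) / h - df w) - ((f (w + k) - f w) / k - df w))%C by ring.
      eapply Rle_trans; [apply Cmod_sub_triangle|]. lra. }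
  exists l. intros eps He.
  assert (HK' : 0 < 4 * K / rho) by (apply Rdiv_lt_0_compat; lra).
  exists (Rmin (rho / 2) (eps / (4 * K / rho))). split.
  { apply Rmin_pos; [lra|apply Rdiv_lt_0_compat; assumption]. }
  intros w Hw. pose proof (Rmin_l (rho / 2) (eps / (4 * K / rho))).
  pose proof (Rmin_r (rho / 2) (eps / (4 * K / rho))).
  destruct (Ceq_dec w p) as [->|E].
  { replace (df p - df p - l * (p - p))%C with (RtoC 0) by ring.
    rewrite Csub_diag, Cmod_0. lra. }
  assert (Hh0 : (w - p)%C <> 0) by (intros E'; apply E; apply Ceq_minus; exact E').
  apply Cmod_gt_0 in Hh0 as Hh.
  specialize (Hl (w - p)%C ltac:(lra)).
  replace (p + (w - p))%C with w in Hl by ring.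
  replace (df w - df p - l * (w - p))%C with (((df w - df p) / (w - p) - l) * (w - p))%C
    by (field; assumption).
  rewrite Cmod_mult. apply Rmult_le_compat_r; [lra|].
  eapply Rle_trans; [apply Hl|].
  assert (A : Cmod (w - p) < eps / (4 * K / rho)) by lra.
  apply Rlt_div_r in A; lra.
Qed.

(** * Division by zeros and automorphisms of the disk *)

Definition holo (f : C -> C) : Prop := forall z, Cmod z < 1 -> exists l, cderiv f z l.

Lemma disk_ball (p z : C) : Cmod (z - p) < 1 - Cmod p -> Cmod z < 1.
Proof.
  intros H. pose proof (Cmod_triangle (z - p) p) as T.
  replace (z - p + p)%C with z in T by ring. lra.
Qed.

Lemma holo_derivative (f df : C -> C) :
  (forall z, Cmod z < 1 -> cderiv f z (df z)) ->
  (forall z, Cmod z < 1 -> Cmod (f z) <= 1) -> holo df.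
Proof.
  intros Hf Hb p Hp.
  apply (cderiv_derivative_ball f df p ((1 - Cmod p) / 4)); [lra| |];
    intros z Hz; [apply Hf|apply Hb]; apply (disk_ball p); lra.
Qed.

(** At the zero the quotient takes the value f'(a), and its derivative there is f''(a) / 2 by a
    second-order expansion; differentiability of f' at a, from [holo_derivative], is what removes
    the singularity. *)
Lemma factor_zero (f : C -> C) (a : C) : holo f ->
  (forall z, Cmod z < 1 -> Cmod (f z) <= 1) -> Cmod a < 1 -> f a = 0 ->
  exists g, holo g /\ forall z, f z = ((z - a) * g z)%C.
Proof.
  intros Hf Hb Ha H0.
  set (df := fun z => epsilon (inhabits (RtoC 0)) (fun l => cderiv f z l)).
  assert (Hdf : forall z, Cmod z < 1 -> cderiv f z (df z)).
  { intros z Hz. unfold df. apply epsilon_spec. apply Hf, Hz. }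
  destruct (holo_derivative f df Hdf Hb a Ha) as [l Hl].
  set (g := fun z => if Ceq_dec z a then df a else (f z / (z - a))%C).
  exists g. split.
  - intros z Hz. destruct (Ceq_dec z a) as [->|E].
    + exists (l / 2)%C. intros eps He.
      destruct (Hl eps He) as [d [Hd H]].
      exists (Rmin d (1 - Cmod a)). split; [apply Rmin_pos; lra|]. intros w Hw.
      pose proof (Rmin_l d (1 - Cmod a)); pose proof (Rmin_r d (1 - Cmod a)).
      unfold g. destruct (Ceq_dec a a) as [_|]; [|congruence].
      destruct (Ceq_dec w a) as [->|E].
      { replace (df a - df a - l / 2 * (a - a))%C with (RtoC 0) by ring.
        rewrite Csub_diag, Cmod_0; lra. }
      assert (Hh0 : (w - a)%C <> 0) by (intros E'; apply E; apply Ceq_minus; exact E').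
      apply Cmod_gt_0 in Hh0 as Hh.
      replace (f w / (w - a) - df a - l / 2 * (w - a))%C with
        ((f w - df a * (w - a) - l / 2 * ((w - a) * (w - a))) / (w - a))%C
        by (field; assumption).
      rewrite Cmod_div by assumption. apply Rle_div_l; [assumption|].
      (* f minus its second-order Taylor polynomial at a has derivative f'(z) - f'(a) - l (z - a),
         of modulus at most eps |w - a| on the segment; the mean value bound gives eps |w - a|^2. *)
      pose proof (cderiv_mean_value
        (fun z => f z - df a * (z - a) - l / 2 * ((z - a) * (z - a)))%C
        (fun z => df z - df a - l * (z - a))%C a w (eps * Cmod (w - a))) as MV.
      cbv beta in MV.
      match type of MV with _ -> Cmod ?X <= _ =>
        replace X with (f w - df a * (w - a) - l / 2 * ((w - a) * (w - a)))%C in MV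
          by (rewrite H0; ring) end.
      apply MV. intros t Ht.
      pose proof (Cmod_scal_le t (w - a) Ht) as Hs.
      assert (Hin : Cmod (a + RtoC t * (w - a) - a) <= Cmod (w - a)).
      { replace (a + RtoC t * (w - a) - a)%C with (RtoC t * (w - a))%C by ring. exact Hs. }
      split.
      * eapply cderiv_eq.
        { apply cderiv_minus; [apply cderiv_minus; [apply Hdf; apply (disk_ball a); lra|]|].
          - apply cderiv_scal. apply cderiv_minus; [apply cderiv_id|apply cderiv_const].
          - apply cderiv_scal.
            apply cderiv_mult; (apply cderiv_minus; [apply cderiv_id|apply cderiv_const]). }
        cbv beta. field.
      * eapply Rle_trans; [apply H; lra|]. apply Rmult_le_compat_l; lra.
    + assert (Hh0 : (z - a)%C <> 0) by (intros E'; apply E; apply Ceq_minus; exact E').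
      apply Cmod_gt_0 in Hh0 as Hh. eexists.
      apply (cderiv_ext (fun z => f z / (z - a))%C g z _ (Cmod (z - a)) Hh).
      * intros w Hw. unfold g. destruct (Ceq_dec w a) as [->|]; [|reflexivity].
        rewrite Cmod_sub_sym in Hw. lra.
      * apply cderiv_div; [exact Hh0|apply Hdf, Hz|].
        apply cderiv_minus; [apply cderiv_id|apply cderiv_const].
  - intros z. unfold g. destruct (Ceq_dec z a) as [->|E].
    + rewrite H0. ring.
    + field. intros E'; apply E; apply Ceq_minus; exact E'.
Qed.

Definition blf (a z : C) : C := ((z - a) / (1 - Cconj a * z))%C.

(** Divided by the first square, this computes 1 - |blf a z|^2: the source both of the invariance of
    the disk and of the size of [blf a] near the circle. *)
Lemma blf_num_den (a z : C) :
  Cmod (1 - Cconj a * z) ^ 2 - Cmod (z - a) ^ 2 = (1 - Cmod a ^ 2) * (1 - Cmod z ^ 2).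
Proof. rewrite !Cmod2_alt. destruct a, z. unfold Re, Im; simpl. ring. Qed.

Lemma den_lower (a z : C) : 1 - Cmod a * Cmod z <= Cmod (1 - Cconj a * z).
Proof.
  pose proof (Cmod_triangle_inv 1 (Cconj a * z)) as H.
  rewrite Cmod_1, Cmod_mult, Cmod_conj in H. exact H.
Qed.

Lemma den_upper (a z : C) : Cmod (1 - Cconj a * z) <= 1 + Cmod a * Cmod z.
Proof.
  pose proof (Cmod_sub_triangle 1 (Cconj a * z)) as H.
  rewrite Cmod_1, Cmod_mult, Cmod_conj in H. exact H.
Qed.

Lemma den_lower_disk (a z : C) : Cmod a < 1 -> Cmod z < 1 -> 1 - Cmod a <= Cmod (1 - Cconj a * z).
Proof.
  intros. pose proof (den_lower a z). pose proof (Cmod_ge_0 a); pose proof (Cmod_ge_0 z). nra.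
Qed.

Lemma den_neq_0 (a z : C) : Cmod a < 1 -> Cmod z < 1 -> (1 - Cconj a * z)%C <> 0.
Proof. intros Ha Hz. apply Cmod_gt_0. pose proof (den_lower_disk a z Ha Hz). lra. Qed.

Lemma blf_mod (a z : C) : Cmod a < 1 -> Cmod z < 1 ->
  1 - Cmod (blf a z) ^ 2 = (1 - Cmod a ^ 2) * (1 - Cmod z ^ 2) / Cmod (1 - Cconj a * z) ^ 2.
Proof.
  intros Ha Hz. pose proof (den_neq_0 a z Ha Hz) as Hd. apply Cmod_gt_0 in Hd as Hm.
  rewrite <- blf_num_den. unfold blf. rewrite Cmod_div by assumption. field. lra.
Qed.

Lemma one_sub_sq_pos (z : C) : Cmod z < 1 -> 0 < 1 - Cmod z ^ 2 <= 1.
Proof. intros H. pose proof (Cmod_ge_0 z). nra. Qed.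

Lemma blf_disk (a z : C) : Cmod a < 1 -> Cmod z < 1 -> Cmod (blf a z) < 1.
Proof.
  intros Ha Hz. pose proof (blf_mod a z Ha Hz) as H.
  pose proof (den_neq_0 a z Ha Hz) as Hd. apply Cmod_gt_0 in Hd.
  pose proof (one_sub_sq_pos a Ha). pose proof (one_sub_sq_pos z Hz).
  assert (0 < 1 - Cmod (blf a z) ^ 2).
  { rewrite H. apply Rdiv_lt_0_compat; [nra|apply pow_lt; assumption]. }
  pose proof (Cmod_ge_0 (blf a z)). nra.
Qed.

Lemma cderiv_blf (a z : C) : Cmod a < 1 -> Cmod z < 1 ->
  cderiv (blf a) z (RtoC (1 - Cmod a ^ 2) / ((1 - Cconj a * z) * (1 - Cconj a * z))).
Proof.
  intros Ha Hz. pose proof (den_neq_0 a z Ha Hz) as Hd.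
  eapply cderiv_eq.
  - apply cderiv_div; [exact Hd| |].
    + apply cderiv_minus; [apply cderiv_id|apply cderiv_const].
    + apply cderiv_minus; [apply cderiv_const|apply cderiv_scal, cderiv_id].
  - cbv beta. f_equal. rewrite RtoC_minus, Cmod2_conj. ring.
Qed.

Lemma one_sub_blf_le (a z : C) : Cmod a < 1 -> Cmod z < 1 ->
  1 - Cmod (blf a z) ^ 2 <= (1 - Cmod z ^ 2) / (1 - Cmod a) ^ 2.
Proof.
  intros Ha Hz. rewrite blf_mod by assumption.
  pose proof (den_lower_disk a z Ha Hz) as Hd. pose proof (one_sub_sq_pos a Ha).
  pose proof (one_sub_sq_pos z Hz). unfold Rdiv.
  apply Rmult_le_compat; [nra| |nra|].
  - left. apply Rinv_0_lt_compat, pow_lt. lra.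
  - apply Rinv_le_contravar; [apply pow_lt; lra|]. apply pow_incr; lra.
Qed.

Lemma blf_opp_0 (p : C) : blf (- p) 0 = p.
Proof. unfold blf. rewrite Cmult_0_r. field. Qed.

(** Precomposition with [blf (- p)] carries the centre to p, so [centre_bound] applies; circles
    close to the unit circle land in the boundary layer where f is controlled. *)
Lemma max_principle (f : C -> C) (M : R) : holo f ->
  (forall eps, 0 < eps -> exists x, 0 < x /\
     forall z, Cmod z < 1 -> 1 - Cmod z ^ 2 < x -> Cmod (f z) <= M + eps) ->
  forall p, Cmod p < 1 -> Cmod (f p) <= M.
Proof.
  intros Hf Hb p Hp. apply le_epsilon. intros eps He.
  destruct (Hb eps He) as [x [Hx H]].
  assert (Hp' : Cmod (- p) < 1) by (rewrite Cmod_opp; exact Hp).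
  set (k := (1 - Cmod (- p)) ^ 2). assert (Hk : 0 < k) by (apply pow_lt; lra).
  (* From 1 - r <= x k / 4 follows 1 - r^2 < x k, so the image circle lies in the layer given by x;
     the cap 1/2 keeps r positive. *)
  set (r := 1 - Rmin (1 / 2) (x * k / 4)).
  pose proof (Rmin_l (1 / 2) (x * k / 4)). pose proof (Rmin_r (1 / 2) (x * k / 4)).
  assert (Hm : 0 < Rmin (1 / 2) (x * k / 4)) by (apply Rmin_pos; nra).
  rewrite <- (blf_opp_0 p).
  assert (DF : forall z, Cmod z < 1 -> exists l, cderiv (fun w => f (blf (- p) w)) z l).
  { intros z Hz. destruct (Hf (blf (- p) z)) as [l Hl]; [apply blf_disk; assumption|].
    eexists. apply cderiv_comp; [exact Hl|apply cderiv_blf; assumption]. }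
  apply (centre_bound (fun w => f (blf (- p) w)) 1 r).
  - intros z [_ Hz]. apply DF, Hz.
  - intros e Hepos. destruct (DF 0) as [l Hl]; [rewrite Cmod_0; lra|].
    destruct (cderiv_cont _ _ _ Hl e Hepos) as [d [Hd Hc]]. exists d; split; [assumption|].
    intros z Hz. apply Hc. replace (z - 0)%C with z by ring. exact Hz.
  - unfold r; lra.
  - intros z Hz. assert (Hz1 : Cmod z < 1) by (rewrite Hz; unfold r; lra).
    apply H; [apply blf_disk; assumption|].
    eapply Rle_lt_trans; [apply one_sub_blf_le; assumption|]. fold k.
    apply Rlt_div_l; [assumption|]. rewrite Hz. unfold r. nra.
Qed.

(** |blf a| tends to 1 at the circle, so the quotient is at most 1 + eps near it, and the maximum
    principle carries this inside for every eps. *)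
Lemma schwarz_factor (f : C -> C) (a : C) : holo f ->
  (forall z, Cmod z < 1 -> Cmod (f z) <= 1) -> Cmod a < 1 -> f a = 0 ->
  exists g, holo g /\ (forall z, Cmod z < 1 -> Cmod (g z) <= 1) /\
    forall z, Cmod z < 1 -> f z = (blf a z * g z)%C.
Proof.
  intros Hf Hb Ha H0. destruct (factor_zero f a Hf Hb Ha H0) as [g0 [Hg0 E0]].
  set (g := fun z => ((1 - Cconj a * z) * g0 z)%C).
  assert (Hg : holo g).
  { intros z Hz. destruct (Hg0 z Hz) as [l Hl]. eexists. apply cderiv_mult; [|exact Hl].
    apply cderiv_minus; [apply cderiv_const|apply cderiv_scal, cderiv_id]. }
  assert (E : forall z, Cmod z < 1 -> f z = (blf a z * g z)%C).
  { intros z Hz. rewrite E0. unfold g, blf. field. apply den_neq_0; assumption. }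
  exists g. repeat split; [assumption| |assumption].
  apply max_principle; [assumption|]. intros eps He.
  set (k := (1 - Cmod a) ^ 2). assert (Hk : 0 < k) by (apply pow_lt; lra).
  (* The number e = eps / (1 + eps) solves 1 / (1 - e) = 1 + eps: it is the loss allowed in |blf a
     z|. *)
  assert (He1 : 0 < eps / (1 + eps)) by (apply Rdiv_lt_0_compat; lra).
  exists (k * (eps / (1 + eps))). split; [nra|]. intros z Hz Hx.
  pose proof (one_sub_blf_le a z Ha Hz) as H1. fold k in H1.
  assert (H2 : (1 - Cmod z ^ 2) / k < eps / (1 + eps)) by (apply Rlt_div_l; lra).
  assert (H3 : eps / (1 + eps) * (1 + eps) = eps) by (field; lra).
  pose proof (blf_disk a z Ha Hz) as H4. pose proof (Cmod_ge_0 (blf a z)) as H5.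
  assert (H6 : 1 - eps / (1 + eps) < Cmod (blf a z)) by nra.
  pose proof (Hb z Hz) as H7. rewrite E, Cmod_mult in H7 by assumption.
  pose proof (Cmod_ge_0 (g z)).
  set (b := Cmod (blf a z)) in *. set (e := eps / (1 + eps)) in *. set (G := Cmod (g z)) in *.
  assert ((1 - e) * G <= 1) by nra. assert (((1 - e) * G) * (1 + eps) <= 1 * (1 + eps)).
  { apply Rmult_le_compat_r; lra. }
  assert ((1 - e) * (1 + eps) = 1) by lra. nra.
Qed.

Section SchwarzPick.
Variable phi : C -> C.
Hypothesis phi_holo : holo phi.
Hypothesis phi_disk : forall z, Cmod z < 1 -> Cmod (phi z) < 1.

Lemma schwarz_pick_factor (p : C) : Cmod p < 1 ->
  exists g, holo g /\ (forall z, Cmod z < 1 -> Cmod (g z) <= 1) /\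
    forall z, Cmod z < 1 -> blf (phi p) (phi z) = (blf p z * g z)%C.
Proof.
  intros Hp. apply (schwarz_factor (fun z => blf (phi p) (phi z))); [| |assumption|].
  - intros z Hz. destruct (phi_holo z Hz) as [l Hl]. eexists.
    apply cderiv_comp; [apply cderiv_blf; apply phi_disk; assumption|exact Hl].
  - intros z Hz. left. apply blf_disk; apply phi_disk; assumption.
  - unfold blf. rewrite Csub_diag. field. apply den_neq_0; apply phi_disk; assumption.
Qed.

(** Denominators are cleared so that a bound on 1 - |phi p|^2 by a multiple of 1 - |p|^2 can be
    inserted and the factor 1 - |p|^2 cancelled. *)
Lemma schwarz_pick (p z : C) : Cmod p < 1 -> Cmod z < 1 ->
  (1 - Cmod p ^ 2) * (1 - Cmod z ^ 2) * Cmod (1 - Cconj (phi p) * phi z) ^ 2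
  <= (1 - Cmod (phi p) ^ 2) * (1 - Cmod (phi z) ^ 2) * Cmod (1 - Cconj p * z) ^ 2.
Proof.
  intros Hp Hz. destruct (schwarz_pick_factor p Hp) as [g [_ [Hg E]]].
  pose proof (phi_disk p Hp) as Hp'. pose proof (phi_disk z Hz) as Hz'.
  specialize (E z Hz). specialize (Hg z Hz).
  assert (L : Cmod (blf (phi p) (phi z)) <= Cmod (blf p z)).
  { rewrite E, Cmod_mult. pose proof (Cmod_ge_0 (blf p z)). nra. }
  assert (L2 : 1 - Cmod (blf p z) ^ 2 <= 1 - Cmod (blf (phi p) (phi z)) ^ 2).
  { pose proof (Cmod_ge_0 (blf (phi p) (phi z))). nra. }
  rewrite !blf_mod in L2 by assumption.
  pose proof (den_neq_0 _ _ Hp Hz) as D1. apply Cmod_gt_0 in D1.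
  pose proof (den_neq_0 _ _ Hp' Hz') as D2. apply Cmod_gt_0 in D2.
  apply (pow_lt _ 2) in D1. apply (pow_lt _ 2) in D2.
  apply (proj1 (Rle_div_l _ _ _ D1)) in L2.
  match type of L2 with _ <= ?A / ?B * ?X => replace (A / B * X) with (A * X / B) in L2 by (unfold Rdiv; ring) end.
  exact (proj2 (Rle_div_r _ _ _ D2) L2).
Qed.

(** Differentiate the factorization of [schwarz_pick_factor] at p: the term with g' vanishes because
    blf p p = 0, and the rest reduces to |g p| <= 1. *)
Lemma schwarz_pick_deriv (p l : C) : Cmod p < 1 -> cderiv phi p l ->
  (1 - Cmod p ^ 2) * Cmod l <= 1 - Cmod (phi p) ^ 2.
Proof.
  intros Hp Hl. destruct (schwarz_pick_factor p Hp) as [g [Hgh [Hg E]]].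
  pose proof (phi_disk p Hp) as Hp'.
  destruct (Hgh p Hp) as [lg Hlg].
  pose proof (cderiv_comp (blf (phi p)) phi p _ _ (cderiv_blf _ _ Hp' Hp') Hl) as D1.
  pose proof (cderiv_mult (blf p) g p _ _ (cderiv_blf _ _ Hp Hp) Hlg) as D2.
  assert (D3 : cderiv (fun z => blf (phi p) (phi z)) p
     (RtoC (1 - Cmod p ^ 2) / ((1 - Cconj p * p) * (1 - Cconj p * p)) * g p + blf p p * lg)).
  { apply (cderiv_ext (fun z => blf p z * g z)%C _ p _ (1 - Cmod p)); [lra| |exact D2].
    intros w Hw. symmetry. apply E. apply (disk_ball p), Hw. }
  pose proof (cderiv_unique _ _ _ _ D1 D3) as U.
  assert (S : forall a : C, (1 - Cconj a * a)%C = RtoC (1 - Cmod a ^ 2)).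
  { intros a. rewrite RtoC_minus, Cmod2_conj. ring. }
  rewrite !S in U.
  pose proof (one_sub_sq_pos _ Hp) as [P1 _]. pose proof (one_sub_sq_pos _ Hp') as [P2 _].
  set (A := 1 - Cmod p ^ 2) in *. set (B := 1 - Cmod (phi p) ^ 2) in *.
  assert (A0 : RtoC A <> 0) by (intros X; apply RtoC_inj in X; lra).
  assert (B0 : RtoC B <> 0) by (intros X; apply RtoC_inj in X; lra).
  assert (U' : (RtoC A * l)%C = (RtoC B * g p)%C).
  { assert (Z : blf p p = 0).
    { unfold blf. rewrite S, Csub_diag. fold A. field; assumption. }
    rewrite Z in U.
    replace (RtoC A * l)%C with (RtoC A * RtoC B * (RtoC B / (RtoC B * RtoC B) * l))%C
      by (field; assumption).
    rewrite U. field; assumption. }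
  assert (N : A * Cmod l = B * Cmod (g p)).
  { apply (f_equal Cmod) in U'. rewrite !Cmod_mult, !Cmod_R, !Rabs_pos_eq in U' by lra. exact U'. }
  specialize (Hg p Hp). rewrite N. nra.
Qed.
End SchwarzPick.

(** * Finite Blaschke products and Julia's lemma *)

(** With c the conjugate of g z, Re (c g) is at most 1 near z and equals 1 at z. Its derivative
    along h, the conjugate of c l, is |c l|^2, which must therefore vanish. *)
Lemma deriv_of_unimodular (g : C -> C) (z l : C) (d : R) : 0 < d ->
  (forall w, Cmod (w - z) < d -> Cmod (g w) = 1) -> cderiv g z l -> l = 0.
Proof.
  intros Hd H1 Hl.
  set (c := Cconj (g z)). set (h := Cconj (c * l)).
  assert (D : derivable_pt_lim (fun s => Re (c * g (z + RtoC s * h)%C)) 0 (Re (c * (l * h)))).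
  { apply is_derive_Reals, cderiv_is_derive_re.
    replace (z + RtoC 0 * h)%C with z by ring. exact Hl. }
  assert (Hgz : Cmod (g z) = 1) by (apply H1; rewrite Csub_diag, Cmod_0; assumption).
  assert (Hc : Cmod c = 1) by (unfold c; rewrite Cmod_conj; exact Hgz).
  pose proof (Cmod_ge_0 h) as Hh.
  set (e := d / (Cmod h + 1)).
  assert (He : 0 < e) by (apply Rdiv_lt_0_compat; lra).
  set (pr := exist _ _ D : derivable_pt (fun s => Re (c * g (z + RtoC s * h)%C)) 0).
  assert (E : derive_pt _ 0 pr = 0).
  { apply (deriv_maximum _ (- e) e); [lra|lra|]. intros s Hs1 Hs2.
    replace (z + RtoC 0 * h)%C with z by ring.
    replace (c * g z)%C with (RtoC 1).
    - rewrite re_RtoC. eapply Rle_trans; [apply Re_le_Cmod|].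
      rewrite Cmod_mult, Hc, H1; [lra|].
      replace (z + RtoC s * h - z)%C with (RtoC s * h)%C by ring.
      rewrite Cmod_mult, Cmod_R.
      assert (Hs : Rabs s < e) by (apply Rabs_def1; lra).
      unfold e in Hs. apply Rlt_div_r in Hs; [|lra]. pose proof (Rabs_pos s). nra.
    - unfold c. rewrite Cmult_comm, <- Cmod2_conj, Hgz. f_equal; ring. }
  rewrite (derive_pt_eq_0 _ _ _ pr D) in E.
  replace (c * (l * h))%C with ((c * l) * Cconj (c * l))%C in E by (unfold h; ring).
  rewrite <- Cmod2_conj, re_RtoC, Cmod_mult, Hc in E.
  apply Cmod_eq_0. pose proof (Cmod_ge_0 l). nra.
Qed.

(** The lower bound forces |1 / g| <= 1 + eps near the circle; the maximum principle for 1 / g then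
    gives |g| = 1 throughout, so g' = 0. *)
Lemma zero_free_constant (g : C -> C) (K : R) : 0 < K -> holo g ->
  (forall z, Cmod z < 1 -> Cmod (g z) <= 1) ->
  (forall z, Cmod z < 1 -> 1 - Cmod (g z) <= K * (1 - Cmod z)) ->
  (forall z, Cmod z < 1 -> g z <> 0) ->
  exists c, Cmod c = 1 /\ forall z, Cmod z < 1 -> g z = c.
Proof.
  intros HK Hg H1 Hlow Hnz.
  assert (U : forall z, Cmod z < 1 -> Cmod (g z) = 1).
  { assert (Hi : forall z, Cmod z < 1 -> Cmod (/ g z) <= 1).
    { apply max_principle.
      - intros z Hz. destruct (Hg z Hz) as [l Hl]. eexists.
        apply cderiv_inv; [apply Hnz, Hz|exact Hl].
      - intros eps He.
        assert (He1 : 0 < eps / (1 + eps)) by (apply Rdiv_lt_0_compat; lra).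
        assert (E : eps / (1 + eps) * (1 + eps) = eps) by (field; lra).
        exists (eps / (1 + eps) / K). split; [apply Rdiv_lt_0_compat; assumption|].
        intros z Hz Hx. apply Rlt_div_r in Hx; [|assumption].
        rewrite Cmod_inv by (apply Hnz, Hz).
        specialize (Hlow z Hz). pose proof (Cmod_ge_0 z).
        assert (B : 1 - eps / (1 + eps) <= Cmod (g z)) by nra.
        replace (1 + eps) with (/ (1 - eps / (1 + eps))) by (field; lra).
        apply Rinv_le_contravar; [|assumption].
        assert (eps / (1 + eps) < 1) by (apply Rlt_div_l; lra). lra. }
    intros z Hz. apply Rle_antisym; [apply H1, Hz|].
    specialize (Hi z Hz). rewrite Cmod_inv in Hi by (apply Hnz, Hz).
    pose proof (proj1 (Cmod_gt_0 _) (Hnz z Hz)) as Hp.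
    apply Rnot_lt_le; intros Hlt.
    apply Rinv_lt_contravar in Hlt; [|lra]. rewrite Rinv_1 in Hlt. lra. }
  assert (Hz0 : Cmod 0 < 1) by (rewrite Cmod_0; lra).
  exists (g 0). split; [apply U, Hz0|]. intros z Hz.
  apply Ceq_minus, Cmod_eq_0, Rle_antisym; [|apply Cmod_ge_0].
  replace 0 with (0 * Cmod (z - 0)) at 2 by ring.
  apply (cderiv_mean_value g (fun _ => 0)). intros t Ht.
  rewrite Cmod_0. split; [|lra].
  assert (Hin : Cmod (0 + RtoC t * (z - 0)) < 1).
  { pose proof (Cmod_scal_le t z Ht).
    replace (0 + RtoC t * (z - 0))%C with (RtoC t * z)%C by ring. lra. }
  destruct (Hg _ Hin) as [l Hl]. eapply cderiv_eq; [exact Hl|].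
  eapply deriv_of_unimodular; [| |exact Hl]; [apply (proj2 (Rlt_0_minus _ _) Hin)|].
  intros w Hw. apply U. eapply disk_ball, Hw.
Qed.

Definition bprod (l : list C) (z : C) : C :=
  fold_right (fun a acc => Cmult (blf a z) acc) (RtoC 1) l.

(** A zero a obeys 1 <= k (1 - |a|), hence stays away from the circle, and each Blaschke factor then
    costs a fixed proportion of modulus at one test point [z1], where phi is not small. Quotients
    inherit the boundary estimate: division by a product of modulus at most 1 does not decrease the
    modulus. *)
Lemma finite_blaschke_of_boundary (phi : C -> C) (K : R) : holo phi ->
  (forall z, Cmod z < 1 -> Cmod (phi z) <= 1) ->
  (forall z, Cmod z < 1 -> 1 - Cmod (phi z) <= K * (1 - Cmod z)) ->
  exists c l, Cmod c = 1 /\ (forall a, In a l -> Cmod a < 1) /\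
    forall z, Cmod z < 1 -> phi z = (c * bprod l z)%C.
Proof.
  intros Hphi H1 Hlow'.
  set (k := Rmax K 1). assert (Hk : 1 <= k) by apply Rmax_r.
  assert (Hlow : forall z, Cmod z < 1 -> 1 - Cmod (phi z) <= k * (1 - Cmod z)).
  { intros z Hz. specialize (Hlow' z Hz). pose proof (Rmax_l K 1). fold k in H. nra. }
  clearbody k. clear K Hlow'.
  (* Here k (1 - |z1|) = 1/2, so the hypothesis gives |phi z1| >= 1/2. *)
  set (z1 := RtoC (1 - / (2 * k))).
  assert (Hik : 0 < / (2 * k) <= / 2).
  { split; [apply Rinv_0_lt_compat; lra|apply Rinv_le_contravar; lra]. }
  assert (Hkk : k * / (2 * k) = / 2) by (field; lra).
  assert (Mz1 : Cmod z1 = 1 - / (2 * k)) by (unfold z1; rewrite Cmod_R, Rabs_pos_eq; lra).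
  assert (Dz1 : Cmod z1 < 1) by lra.
  assert (Pz1 : / 2 <= Cmod (phi z1)) by (specialize (Hlow z1 Dz1); rewrite Mz1 in Hlow; nra).
  (* The loss per factor: 1 - |blf a z1|^2 >= (1 / k) (1 / (2 k)) / 4, the 4 bounding the squared
     denominator. *)
  set (q := 1 - / (8 * (k * k))).
  assert (Hq : 0 < / (8 * (k * k)) < 1).
  { split; [apply Rinv_0_lt_compat; nra|]. rewrite <- Rinv_1. apply Rinv_lt_contravar; nra. }
  assert (Hfac : forall a, Cmod a < 1 -> 1 <= k * (1 - Cmod a) -> Cmod (blf a z1) ^ 2 <= q).
  { intros a Ha Hka. pose proof (blf_mod a z1 Ha Dz1) as B.
    pose proof (den_upper a z1) as D. pose proof (Cmod_ge_0 a) as A0.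
    pose proof (den_neq_0 a z1 Ha Dz1) as D0. apply Cmod_gt_0 in D0.
    set (E := Cmod (1 - Cconj a * z1)) in *.
    assert (E2 : E <= 2) by nra.
    assert (L : / (8 * (k * k)) <= (1 - Cmod a ^ 2) * (1 - Cmod z1 ^ 2) / E ^ 2).
    { apply Rle_div_r; [apply pow_lt; assumption|].
      assert (X1 : / k <= 1 - Cmod a ^ 2).
      { apply Rle_trans with (1 - Cmod a); [|nra].
        apply (Rmult_le_reg_l k); [lra|]. rewrite Rinv_r by lra. exact Hka. }
      assert (X2 : / (2 * k) <= 1 - Cmod z1 ^ 2) by (rewrite Mz1; nra).
      apply Rle_trans with (/ k * / (2 * k)).
      - apply Rle_trans with (/ (8 * (k * k)) * 4).
        + apply Rmult_le_compat_l; [lra|nra].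
        + right. field. lra.
      - apply Rmult_le_compat; try lra. left; apply Rinv_0_lt_compat; lra. }
    unfold q. lra. }
  (* Either the process has already ended in a zero-free quotient, or n factors have been split
     off. *)
  assert (Main : forall n, (exists c l, Cmod c = 1 /\ (forall a, In a l -> Cmod a < 1) /\
        forall z, Cmod z < 1 -> phi z = (c * bprod l z)%C)
     \/ exists l g, (forall a, In a l -> Cmod a < 1) /\ holo g /\
        (forall z, Cmod z < 1 -> Cmod (g z) <= 1) /\
        (forall z, Cmod z < 1 -> phi z = (g z * bprod l z)%C) /\
        (forall z, Cmod z < 1 -> Cmod (bprod l z) <= 1) /\
        Cmod (bprod l z1) ^ 2 <= q ^ n).
  { induction n as [|n [IH|[l [g [Hl [Hg [Hg1 [E [Hb Hq1]]]]]]]]]; [right| |].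
    - exists nil, phi. simpl. repeat split; try assumption.
      + intros a [].
      + intros z Hz. ring.
      + intros z Hz. rewrite Cmod_1. lra.
      + rewrite Cmod_1. lra.
    - left; exact IH.
    - assert (Glow : forall z, Cmod z < 1 -> 1 - Cmod (g z) <= k * (1 - Cmod z)).
      { intros z Hz. specialize (Hlow z Hz). rewrite E, Cmod_mult in Hlow by assumption.
        pose proof (Hb z Hz). pose proof (Cmod_ge_0 (g z)). nra. }
      destruct (classic (exists a, Cmod a < 1 /\ g a = 0)) as [[a [Ha Ga]]|Hno].
      + right. destruct (schwarz_factor g a Hg Hg1 Ha Ga) as [g2 [Hg2 [Hg21 E2]]].
        exists (a :: l), g2. simpl. repeat split; try assumption.
        * intros b [<-|Hb']; [assumption|apply Hl, Hb'].
        * intros z Hz. rewrite E, E2 by assumption. unfold bprod. ring.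
        * intros z Hz. rewrite Cmod_mult. pose proof (blf_disk a z Ha Hz).
          fold (bprod l z). pose proof (Hb z Hz). pose proof (Cmod_ge_0 (blf a z)).
          pose proof (Cmod_ge_0 (bprod l z)). nra.
        * rewrite Cmod_mult. fold (bprod l z1).
          assert (F : Cmod (blf a z1) ^ 2 <= q).
          { apply Hfac; [assumption|]. specialize (Glow a Ha). rewrite Ga, Cmod_0 in Glow. lra. }
          replace ((Cmod (blf a z1) * Cmod (bprod l z1)) * ((Cmod (blf a z1) * Cmod (bprod l z1)) * 1))
            with (Cmod (blf a z1) ^ 2 * Cmod (bprod l z1) ^ 2) by ring.
          apply Rmult_le_compat; try assumption; apply pow2_ge_0.
      + left. destruct (zero_free_constant g k) as [c [Hc Ec]]; try assumption; [lra| |].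
        { intros z Hz Gz. apply Hno. exists z; split; assumption. }
        exists c, l. repeat split; try assumption.
        intros z Hz. rewrite E, Ec by assumption. reflexivity. }
  (* Once q^N < 1/4, the second alternative contradicts |phi z1|^2 >= 1/4. *)
  destruct (pow_lt_1_zero q) with (y := / 4) as [N HN].
  { rewrite Rabs_pos_eq; unfold q; lra. } { lra. }
  specialize (HN N (le_n N)).
  destruct (Main N) as [H|[l [g [_ [_ [Hg1 [E [_ Hq1]]]]]]]]; [exact H|].
  exfalso. rewrite E, Cmod_mult in Pz1 by assumption.
  specialize (Hg1 z1 Dz1). pose proof (Cmod_ge_0 (bprod l z1)). pose proof (Cmod_ge_0 (g z1)).
  pose proof (Rle_abs (q ^ N)). nra.
Qed.

Lemma polar (z : C) : exists t, z = (RtoC (Cmod z) * cis t)%C.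
Proof.
  destruct (Ceq_dec z 0) as [->|Hz].
  { exists 0. rewrite Cmod_0. ring. }
  apply Cmod_gt_0 in Hz. set (r := Cmod z) in *.
  assert (E : r ^ 2 = fst z ^ 2 + snd z ^ 2) by apply Cmod2_alt.
  set (x := fst z / r). set (y := snd z / r).
  assert (Hxy : x ^ 2 + y ^ 2 = 1).
  { unfold x, y. replace ((fst z / r) ^ 2 + (snd z / r) ^ 2) with ((fst z ^ 2 + snd z ^ 2) / r ^ 2)
      by (field; lra). rewrite <- E. field. lra. }
  assert (Hx : -1 <= x <= 1) by nra.
  assert (Hs : sin (acos x) = Rabs y).
  { rewrite sin_acos by assumption. rewrite <- sqrt_Rsqr_abs. f_equal. unfold Rsqr. lra. }
  assert (X : fst z = r * x) by (unfold x; field; lra).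
  assert (Y : snd z = r * y) by (unfold y; field; lra).
  destruct (Rle_dec 0 y) as [Hy|Hy].
  - exists (acos x). rewrite scal_cis, cos_acos, Hs by assumption.
    rewrite Rabs_pos_eq by assumption. rewrite <- X, <- Y. destruct z; reflexivity.
  - exists (- acos x). rewrite scal_cis, cos_neg, sin_neg, cos_acos, Hs by assumption.
    rewrite Rabs_left, Ropp_involutive by lra. rewrite <- X, <- Y. destruct z; reflexivity.
Qed.

(* Julia's lemma: the Schwarz-Pick inequality between z and points p tending
   to the boundary point nearest to z. *)
Lemma julia (phi : C -> C) (K : R) : holo phi ->
  (forall z, Cmod z < 1 -> Cmod (phi z) < 1) ->
  (forall t d, 0 < d -> exists z, Cmod z < 1 /\ Cmod (z - cis t) < d /\
     1 - Cmod (phi z) ^ 2 <= K * (1 - Cmod z ^ 2)) ->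
  forall z, Cmod z < 1 -> 1 - Cmod (phi z) <= 8 * K * (1 - Cmod z).
Proof.
  intros Hphi Hd Hk z Hz. destruct (polar z) as [t Ht].
  (* One point p this close to the boundary point yields |1 - conj(p) z| <= 2 (1 - |z|): a factor 2
     is lost in place of taking a limit. *)
  destruct (Hk t (1 - Cmod z)) as [p [Hp [Hpt Hpk]]]; [lra|].
  pose proof (schwarz_pick phi Hphi Hd p z Hp Hz) as SP.
  pose proof (Hd z Hz) as Hz'. pose proof (Hd p Hp) as Hp'.
  pose proof (one_sub_sq_pos p Hp) as [P1 _].
  pose proof (one_sub_sq_pos _ Hp') as [P2 _]. pose proof (one_sub_sq_pos _ Hz') as [P3 _].
  pose proof (Cmod_ge_0 z) as Z0. pose proof (Cmod_ge_0 (phi z)) as F0.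
  assert (A1 : Cmod (1 - Cconj p * z) <= 2 * (1 - Cmod z)).
  { replace (1 - Cconj p * z)%C with (RtoC (1 - Cmod z) - Cconj (p - cis t) * z)%C.
    - eapply Rle_trans; [apply Cmod_sub_triangle|].
      rewrite Cmod_mult, Cmod_conj, Cmod_R, Rabs_pos_eq by lra.
      pose proof (Cmod_ge_0 (p - cis t)). nra.
    - rewrite Cminus_conj.
      assert (E : (Cconj (cis t) * z)%C = RtoC (Cmod z)).
      { rewrite Ht at 1.
        replace (Cconj (cis t) * (RtoC (Cmod z) * cis t))%C
          with (RtoC (Cmod z) * (cis t * Cconj (cis t)))%C by ring.
        rewrite <- Cmod2_conj, Cmod_cis. rewrite <- RtoC_mult. f_equal. ring. }
      replace ((Cconj p - Cconj (cis t)) * z)%C with (Cconj p * z - Cconj (cis t) * z)%C by ring.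
      rewrite E, RtoC_minus. ring. }
  assert (A2 : 1 - Cmod (phi z) <= Cmod (1 - Cconj (phi p) * phi z)).
  { pose proof (den_lower (phi p) (phi z)). pose proof (Cmod_ge_0 (phi p)). nra. }
  pose proof (Cmod_ge_0 (1 - Cconj p * z)) as A0.
  set (x := 1 - Cmod z) in *. set (y := 1 - Cmod (phi z)) in *.
  assert (A3 : Cmod (1 - Cconj p * z) ^ 2 <= (2 * x) ^ 2) by (apply pow_incr; lra).
  assert (A4 : y ^ 2 <= Cmod (1 - Cconj (phi p) * phi z) ^ 2) by (apply pow_incr; split; [unfold y; lra|exact A2]).
  assert (X : 0 < x) by (unfold x; lra). assert (Y : 0 < y) by (unfold y; lra).
  assert (Zx : x <= 1 - Cmod z ^ 2) by (unfold x; nra).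
  assert (Zy : 1 - Cmod (phi z) ^ 2 <= 2 * y) by (unfold y; nra).
  set (a := 1 - Cmod p ^ 2) in *. set (b := 1 - Cmod (phi p) ^ 2) in *.
  set (A := 1 - Cmod z ^ 2) in *. set (B := 1 - Cmod (phi z) ^ 2) in *.
  (* The 8 is 2 from 1 - |phi z|^2 <= 2 y times 4 from (2 x)^2; the factor a cancels afterwards. *)
  assert (I1 : (a * (x * y ^ 2)) <= a * (K * 8 * y * x ^ 2)).
  { apply Rle_trans with (a * A * Cmod (1 - Cconj (phi p) * phi z) ^ 2).
    - rewrite <- Rmult_assoc. apply Rmult_le_compat; [nra|nra|nra|assumption].
    - eapply Rle_trans; [exact SP|].
      apply Rle_trans with ((K * a) * (2 * y) * (2 * x) ^ 2); [|right; ring].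
      apply Rmult_le_compat; [nra|apply pow2_ge_0| |assumption].
      apply Rmult_le_compat; lra. }
  apply Rmult_le_reg_l in I1; [|assumption].
  apply (Rmult_le_reg_l (x * y)); [nra|]. lra.
Qed.

(** * Local hyperbolic distortion *)

Lemma Rpower_pos (x y : R) : 0 < Rpower x y.
Proof. apply exp_pos. Qed.

Lemma Rpower_monotone (x y e : R) : 0 < x -> x <= y -> 0 <= e -> Rpower x e <= Rpower y e.
Proof.
  intros Hx Hxy He. destruct (Req_dec x y) as [->|Hne]; [lra|].
  destruct (Req_dec e 0) as [->|Hne'].
  - rewrite !Rpower_O; lra.
  - left. apply Rlt_Rpower_l; lra.
Qed.

Lemma le_of_Rpower_le (x y e : R) : 0 < x -> 0 < e -> Rpower x e <= y -> x <= Rpower y (/ e).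
Proof.
  intros Hx He H. rewrite <- (Rpower_1 x Hx) at 1. replace 1 with (e * / e) by (field; lra).
  rewrite <- Rpower_mult. apply Rpower_monotone; [apply Rpower_pos|assumption|].
  left; apply Rinv_0_lt_compat; assumption.
Qed.

Lemma Rpower_div_mult (a b e : R) : 0 < a -> 0 < b -> Rpower (a / b) e * Rpower b e = Rpower a e.
Proof.
  intros Ha Hb. rewrite Rpower_mult_distr by (try assumption; apply Rdiv_lt_0_compat; assumption).
  f_equal. field; lra.
Qed.

(** Since (B/A)^alpha A = B^alpha A^(1 - alpha) with both exponents positive, the bounds on A and B
    can be used separately. Against the factor 1 - r^2, the half-speed bound on B gains the power (1
    - r)^(alpha / 2). *)
Lemma power_comparison (A A0 B B0 r alpha : R) :
  0 < A -> 0 < A0 -> 0 < B -> 0 < B0 -> 0 < r < 1 -> 0 < alpha < 1 ->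
  A0 * (1 - r ^ 2) <= 4 * A -> B0 ^ 2 * (1 - r) <= B ^ 2 * (1 + r) ->
  Rpower (B0 / A0) alpha * A0 * (1 - r ^ 2)
  <= 4 * Rpower (8 * (1 - r)) (alpha / 2) * (Rpower (B / A) alpha * A).
Proof.
  intros HA HA0 HB HB0 Hr Hal H1 H2.
  (* The 8 bounds (1 + r)^3, which appears when B0 (1 - r^2) <= B q is squared. *)
  set (s := 8 * (1 - r)). assert (Hs : 0 < s) by (unfold s; lra).
  pose proof (sqrt_lt_R0 s Hs) as Hq. pose proof (sqrt_sqrt s (Rlt_le _ _ Hs)) as Hqq.
  set (q := sqrt s) in *.
  assert (Hx : 0 < 1 - r ^ 2) by nra.
  assert (I1 : B0 * (1 - r ^ 2) <= B * q).
  { apply Rsqr_incr_0_var; [unfold Rsqr|nra].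
    replace (B * q * (B * q)) with (B ^ 2 * s) by (rewrite <- Hqq; ring). unfold s.
    assert ((1 + r) ^ 3 <= 8) by nra.
    replace (B0 * (1 - r ^ 2) * (B0 * (1 - r ^ 2)))
      with ((B0 ^ 2 * (1 - r)) * ((1 - r) * (1 + r) ^ 2)) by ring.
    apply Rle_trans with ((B ^ 2 * (1 + r)) * ((1 - r) * (1 + r) ^ 2)).
    - apply Rmult_le_compat_r; [|assumption]. apply Rmult_le_pos; [lra|apply pow2_ge_0].
    - replace (B ^ 2 * (1 + r) * ((1 - r) * (1 + r) ^ 2))
        with ((B ^ 2 * (1 - r)) * (1 + r) ^ 3) by ring.
      replace (B ^ 2 * (8 * (1 - r))) with ((B ^ 2 * (1 - r)) * 8) by ring.
      apply Rmult_le_compat_l; [|assumption]. apply Rmult_le_pos; [apply pow2_ge_0|lra]. }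
  assert (J1 : Rpower (B0 * (1 - r ^ 2)) alpha <= Rpower (B * q) alpha)
    by (apply Rpower_monotone; nra).
  assert (J2 : Rpower (A0 * (1 - r ^ 2)) (1 - alpha) <= Rpower (4 * A) (1 - alpha))
    by (apply Rpower_monotone; nra).
  assert (J3 : Rpower 4 (1 - alpha) <= 4).
  { rewrite <- (Rpower_1 4) at 2 by lra. apply Rle_Rpower; lra. }
  assert (Q : Rpower q alpha = Rpower s (alpha / 2)).
  { unfold q. rewrite <- Rpower_sqrt by assumption. rewrite Rpower_mult. f_equal. lra. }
  rewrite <- !Rpower_mult_distr in J1, J2 by lra.
  rewrite Q in J1.
  assert (S : forall a b, 0 < a -> 0 < b -> Rpower (b / a) alpha * a = Rpower b alpha * Rpower a (1 - alpha)).
  { intros a b Ha Hb. rewrite <- (Rpower_div_mult b a alpha Hb Ha), Rmult_assoc, <- Rpower_plus.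
    replace (alpha + (1 - alpha)) with 1 by ring. rewrite Rpower_1 by assumption. reflexivity. }
  rewrite !S by assumption.
  assert (X : 1 - r ^ 2 = Rpower (1 - r ^ 2) alpha * Rpower (1 - r ^ 2) (1 - alpha)).
  { rewrite <- Rpower_plus. replace (alpha + (1 - alpha)) with 1 by ring.
    rewrite Rpower_1 by assumption. reflexivity. }
  rewrite X.
  pose proof (Rpower_pos B0 alpha). pose proof (Rpower_pos (1 - r ^ 2) alpha).
  pose proof (Rpower_pos B alpha). pose proof (Rpower_pos s (alpha / 2)).
  pose proof (Rpower_pos A0 (1 - alpha)). pose proof (Rpower_pos (1 - r ^ 2) (1 - alpha)).
  pose proof (Rpower_pos A (1 - alpha)). pose proof (Rpower_pos 4 (1 - alpha)).
  apply Rle_trans with ((Rpower B alpha * Rpower s (alpha / 2)) *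
                        (Rpower 4 (1 - alpha) * Rpower A (1 - alpha))).
  - eapply Rle_trans; [|apply Rmult_le_compat; [| |exact J1|exact J2]]; [right; ring| |];
      apply Rmult_le_pos; lra.
  - replace (4 * Rpower s (alpha / 2) * (Rpower B alpha * Rpower A (1 - alpha)))
      with ((Rpower B alpha * Rpower s (alpha / 2)) * (4 * Rpower A (1 - alpha))) by ring.
    apply Rmult_le_compat_l; [nra|]. apply Rmult_le_compat_r; lra.
Qed.

(* A path of hyperbolic speed at most 1/2 approaches the circle at the slower
   rate sqrt (1 - r): k ^ 2 * (1 + t) / (1 - t) is nondecreasing. *)
Lemma half_speed_path (psi dpsi : C -> C) (om : C) (r : R) : Cmod om = 1 -> 0 < r < 1 ->
  (forall t, 0 <= t <= r -> cderiv psi (RtoC t * om)%C (dpsi (RtoC t * om)%C) /\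
     Cmod (psi (RtoC t * om)%C) < 1 /\
     (1 - t ^ 2) * Cmod (dpsi (RtoC t * om)%C) <= (1 - Cmod (psi (RtoC t * om)%C) ^ 2) / 2) ->
  (1 - Cmod (psi 0) ^ 2) ^ 2 * (1 - r) <= (1 - Cmod (psi (RtoC r * om)%C) ^ 2) ^ 2 * (1 + r).
Proof.
  intros Hom Hr H.
  set (X := fun t => Re (1 * psi (0 + RtoC t * om)%C)).
  set (Y := fun t => Re (- Ci * psi (0 + RtoC t * om)%C)).
  assert (E0 : forall t : R, (0 + RtoC t * om)%C = (RtoC t * om)%C) by (intros; ring).
  assert (XY : forall t, X t ^ 2 + Y t ^ 2 = Cmod (psi (RtoC t * om)%C) ^ 2).
  { intros t. unfold X, Y. rewrite E0, Cmod2_alt. destruct (psi (RtoC t * om)%C).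
    unfold Re, Im; simpl; ring. }
  assert (DXY : forall t, 0 <= t <= r -> exists X' Y', is_derive X t X' /\ is_derive Y t Y' /\
     X t * X' + Y t * Y' <= Cmod (psi (RtoC t * om)%C) * Cmod (dpsi (RtoC t * om)%C)).
  { intros t Ht. destruct (H t Ht) as [D _].
    set (l := dpsi (RtoC t * om)%C) in *.
    exists (Re (1 * (l * om))), (Re (- Ci * (l * om))). split; [|split].
    - apply cderiv_is_derive_re; rewrite E0; exact D.
    - apply cderiv_is_derive_re; rewrite E0; exact D.
    - replace (X t * Re (1 * (l * om)) + Y t * Re (- Ci * (l * om)))
        with (Re (Cconj (psi (RtoC t * om)%C) * (l * om))).
      + eapply Rle_trans; [apply Re_le_Cmod|].
        rewrite !Cmod_mult, Cmod_conj, Hom. lra.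
      + unfold X, Y. rewrite E0. destruct (psi (RtoC t * om)%C), (l * om)%C.
        unfold Re, Im; simpl; ring. }
  clearbody X Y.
  set (V := fun t => (1 - (X t ^ 2 + Y t ^ 2)) ^ 2 * (1 + t) / (1 - t)).
  assert (DV : forall t, 0 <= t <= r -> exists v, is_derive V t v /\ 0 <= v).
  { intros t Ht. destruct (H t Ht) as [_ [Hin Hsp]].
    destruct (DXY t Ht) as [X' [Y' [DX [DY CS]]]].
    set (l := dpsi (RtoC t * om)%C) in *.
    set (k := 1 - (X t ^ 2 + Y t ^ 2)).
    exists (2 * k * (- (2 * (X t * X' + Y t * Y'))) * ((1 + t) / (1 - t)) + k ^ 2 * (2 / (1 - t) ^ 2)).
    split.
    - unfold V. auto_derive.
      + repeat split; try (eexists; eassumption). lra.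
      + replace (Derive (fun x => X x) t) with X' by (symmetry; apply (is_derive_unique X), DX).
        replace (Derive (fun x => Y x) t) with Y' by (symmetry; apply (is_derive_unique Y), DY).
        unfold k. field. lra.
    - rewrite <- XY in Hsp. fold k in Hsp.
      pose proof (Cmod_ge_0 l). pose proof (Cmod_ge_0 (psi (RtoC t * om)%C)).
      assert (CS' : X t * X' + Y t * Y' <= Cmod l) by nra.
      assert (Hk : 0 < k) by (unfold k; rewrite XY; nra).
      assert (Ht2 : 0 < 1 - t) by lra.
      (* This form shows the sign: Cauchy-Schwarz and the speed hypothesis give 2 (1 - t^2) (X X' +
         Y Y') <= k. *)
      replace (2 * k * - (2 * (X t * X' + Y t * Y')) * ((1 + t) / (1 - t)) + k ^ 2 * (2 / (1 - t) ^ 2))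
        with (2 * k / (1 - t) ^ 2 * (k - 2 * ((1 - t ^ 2) * (X t * X' + Y t * Y')))) by (field; lra).
      apply Rmult_le_pos.
      + left. apply Rdiv_lt_0_compat; [lra|apply pow_lt; assumption].
      + assert ((1 - t ^ 2) * (X t * X' + Y t * Y') <= (1 - t ^ 2) * Cmod l); [|lra].
        apply Rmult_le_compat_l; [nra|assumption]. }
  set (dV := fun t => Derive V t).
  destruct (MVT_gen V 0 r dV) as [t [Ht E]].
  - intros t Ht. rewrite Rmin_left, Rmax_right in Ht by lra.
    destruct (DV t ltac:(lra)) as [v [Hv _]]. apply Derive_correct. exists v; exact Hv.
  - intros t Ht. rewrite Rmin_left, Rmax_right in Ht by lra.
    destruct (DV t Ht) as [v [Hv _]]. apply continuity_pt_filterlim.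
    apply (ex_derive_continuous V t). exists v; exact Hv.
  - rewrite Rmin_left, Rmax_right in Ht by lra.
    destruct (DV t Ht) as [v [Hv Hpos]]. unfold dV in E. rewrite (is_derive_unique _ _ _ Hv) in E.
    assert (L : V 0 <= V r) by nra.
    unfold V in L. rewrite !XY in L. replace (RtoC 0 * om)%C with (RtoC 0) in L by ring.
    apply Rle_div_r in L; [|lra].
    replace ((1 - Cmod (psi 0) ^ 2) ^ 2 * (1 + 0) / (1 - 0) * (1 - r))
      with ((1 - Cmod (psi 0) ^ 2) ^ 2 * (1 - r)) in L by field. exact L.
Qed.

Section Distortion.
Variables phi dphi : C -> C.
Hypothesis phi_deriv : forall z, Cmod z < 1 -> cderiv phi z (dphi z).
Hypothesis phi_disk : forall z, Cmod z < 1 -> Cmod (phi z) < 1.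

(** The quotient u of the overview. Gathering both powers of [tau] into one power of u lets the
    bounds be solved for u. *)
Definition defect (z : C) : R := (1 - Cmod (phi z) ^ 2) / (1 - Cmod z ^ 2).
Definition distortion (alpha : R) (z : C) : R := Cmod (dphi z) / Rpower (defect z) alpha.

Lemma phi_is_holo : holo phi.
Proof. intros z Hz. exists (dphi z). apply phi_deriv, Hz. Qed.

Lemma defect_pos (z : C) : Cmod z < 1 -> 0 < defect z.
Proof.
  intros Hz. apply Rdiv_lt_0_compat; apply one_sub_sq_pos; [apply phi_disk|]; exact Hz.
Qed.

Lemma deriv_le_defect (z : C) : Cmod z < 1 -> Cmod (dphi z) <= defect z.
Proof.
  intros Hz. apply Rle_div_r; [apply one_sub_sq_pos, Hz|]. rewrite Rmult_comm.
  apply schwarz_pick_deriv; [apply phi_is_holo|assumption|assumption|apply phi_deriv, Hz].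
Qed.

Lemma defect_bound_gt1 (alpha c : R) (z : C) : 1 < alpha -> 0 < c -> Cmod z < 1 ->
  c <= distortion alpha z -> defect z <= Rpower (/ c) (/ (alpha - 1)).
Proof.
  intros Ha Hc Hz H. pose proof (defect_pos z Hz) as Hx. pose proof (deriv_le_defect z Hz) as Hd.
  apply le_of_Rpower_le; [assumption|lra|].
  unfold distortion in H. set (x := defect z) in *. pose proof (Rpower_pos x alpha).
  apply (proj2 (Rle_div_r _ _ _ H0)) in H.
  assert (E : Rpower x alpha = Rpower x (alpha - 1) * x).
  { rewrite <- (Rpower_1 x Hx) at 3. rewrite <- Rpower_plus. f_equal. ring. }
  rewrite E in H.
  apply (Rmult_le_reg_l (c * x)); [nra|].
  replace (c * x * / c) with x by (field; lra). lra.
Qed.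

(** Here u <= 2 |phi'| <= 2 M u^alpha; dividing by u^alpha leaves the positive exponent 1 -
    alpha. *)
Lemma defect_bound_lt1 (alpha M : R) (z : C) : 0 < alpha < 1 -> Cmod z < 1 ->
  distortion alpha z <= M -> defect z <= 2 * Cmod (dphi z) ->
  defect z <= Rpower (2 * M) (/ (1 - alpha)).
Proof.
  intros Ha Hz H Hd. pose proof (defect_pos z Hz) as Hx.
  apply le_of_Rpower_le; [assumption|lra|].
  unfold distortion in H. set (x := defect z) in *. pose proof (Rpower_pos x alpha).
  apply (proj1 (Rle_div_l _ _ _ H0)) in H.
  apply (Rmult_le_reg_r (Rpower x alpha)); [assumption|].
  rewrite <- Rpower_plus. replace (1 - alpha + alpha) with 1 by ring.
  rewrite Rpower_1 by assumption. lra.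
Qed.

(* If the hyperbolic distortion stayed below 1/2 on a large hyperbolic disk,
   then, with psi = phi composed with a disk automorphism, 1 / psi' would be much
   smaller on a circle than at its centre. *)
Lemma exists_large_distortion (alpha c M : R) : 0 < alpha < 1 -> 0 < c -> 0 < M ->
  (forall z, Cmod z < 1 -> distortion alpha z <= M) ->
  exists r, 0 < r < 1 /\ forall z0, Cmod z0 < 1 ->
    (forall w, Cmod w < (1 + r) / 2 -> c <= distortion alpha (blf (- z0) w)) ->
    exists w, Cmod w <= r /\ defect (blf (- z0) w) <= 2 * Cmod (dphi (blf (- z0) w)).
Proof.
  intros Ha Hc HM Hub.
  (* With s^(alpha / 2) <= c / (8 M) the final comparison becomes T0 c <= T0 c / 2. No z0 enters, so
     r is uniform; the cap 4 keeps r = 1 - s / 8 at least 1/2. *)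
  set (s := Rmin 4 (Rpower (c / (8 * M)) (2 / alpha))).
  assert (Hs : 0 < s) by (apply Rmin_pos; [lra|apply Rpower_pos]).
  assert (Hs4 : s <= 4) by apply Rmin_l.
  assert (Hcm : 0 < c / (8 * M)) by (apply Rdiv_lt_0_compat; lra).
  assert (Hsp : Rpower s (alpha / 2) <= c / (8 * M)).
  { eapply Rle_trans; [apply Rpower_monotone; [assumption|apply Rmin_r|lra]|].
    rewrite Rpower_mult. replace (2 / alpha * (alpha / 2)) with 1 by (field; lra).
    rewrite Rpower_1 by assumption. lra. }
  set (r := 1 - s / 8). assert (Hr : 0 < r < 1) by (unfold r; lra).
  exists r; split; [assumption|]. intros z0 Hz0 Hlow.
  apply NNPP. intros Hno.
  assert (Hsmall : forall w, Cmod w <= r ->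
     2 * Cmod (dphi (blf (- z0) w)) <= defect (blf (- z0) w)).
  { intros w Hw. apply Rnot_lt_le; intros Hlt. apply Hno. exists w; split; [assumption|lra]. }
  assert (Hz0' : Cmod (- z0) < 1) by (rewrite Cmod_opp; exact Hz0).
  set (m := blf (- z0)) in *. set (den := fun w => (1 - Cconj (- z0) * w)%C).
  set (A0 := 1 - Cmod z0 ^ 2).
  assert (HA0 : 0 < A0) by (apply one_sub_sq_pos, Hz0).
  assert (EA0 : 1 - Cmod (- z0) ^ 2 = A0) by (rewrite Cmod_opp; reflexivity).
  set (psi := fun w => phi (m w)).
  set (dpsi := fun w => (dphi (m w) * (RtoC A0 / (den w * den w)))%C).
  assert (Hm : forall w, Cmod w < 1 -> Cmod (m w) < 1) by (intros w Hw; apply blf_disk; assumption).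
  assert (Dpsi : forall w, Cmod w < 1 -> cderiv psi w (dpsi w)).
  { intros w Hw. unfold psi, dpsi. apply cderiv_comp; [apply phi_deriv, Hm, Hw|].
    unfold m, den. rewrite <- EA0. apply cderiv_blf; assumption. }
  assert (Hdp : holo dpsi).
  { apply (holo_derivative psi); [exact Dpsi|]. intros z Hz. left. apply phi_disk, Hm, Hz. }
  assert (Hden : forall w, Cmod w < 1 -> 0 < Cmod (den w))
    by (intros w Hw; apply Cmod_gt_0, den_neq_0; assumption).
  assert (EA : forall w, Cmod w < 1 -> 1 - Cmod (m w) ^ 2 = A0 * (1 - Cmod w ^ 2) / Cmod (den w) ^ 2).
  { intros w Hw. unfold m. rewrite blf_mod, EA0 by assumption. reflexivity. }
  (* Invariance of (1 - |w|^2) |psi'(w)| under the automorphism [m]. *)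
  assert (Edp : forall w, Cmod w < 1 ->
     Cmod (dpsi w) * (1 - Cmod w ^ 2) = Cmod (dphi (m w)) * (1 - Cmod (m w) ^ 2)).
  { intros w Hw. pose proof (Hden w Hw) as Hd. apply Cmod_gt_0 in Hd as Hd0.
    unfold dpsi. rewrite Cmod_mult, Cmod_div, Cmod_mult, Cmod_R, Rabs_pos_eq
      by (try apply Cmult_neq_0; (assumption || lra)).
    rewrite EA by assumption. field. lra. }
  assert (M0 : m 0 = z0) by apply blf_opp_0.
  assert (D0 : Cmod 0 < 1) by (rewrite Cmod_0; lra).
  (* The radius (1 + r) / 2 exceeds r, so that 1 / psi' is holomorphic across the circle of radius
     r. *)
  assert (Hnz : forall w, Cmod w < (1 + r) / 2 -> dpsi w <> 0).
  { intros w Hw E. assert (Hw1 : Cmod w < 1) by lra.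
    pose proof (Edp w Hw1) as Ed. rewrite E, Cmod_0, Rmult_0_l in Ed.
    pose proof (one_sub_sq_pos _ (Hm w Hw1)) as [P _].
    assert (Z : Cmod (dphi (m w)) = 0) by nra.
    specialize (Hlow w Hw). unfold distortion in Hlow. fold m in Hlow. rewrite Z in Hlow.
    unfold Rdiv in Hlow. lra. }
  set (B0 := 1 - Cmod (phi z0) ^ 2).
  assert (HB0 : 0 < B0) by (apply one_sub_sq_pos, phi_disk, Hz0).
  (* The common scale u(z0)^alpha (1 - |z0|^2): |psi'| is at most M times it at the centre, but at
     least 2 M times it on the circle of radius r. *)
  set (T0 := Rpower (B0 / A0) alpha * A0).
  assert (HT0 : 0 < T0) by (apply Rmult_lt_0_compat; [apply Rpower_pos|assumption]).
  assert (Up0 : Cmod (dpsi 0) <= M * T0).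
  { pose proof (Edp 0 D0) as E. rewrite Cmod_0, M0 in E. fold A0 in E.
    specialize (Hub z0 Hz0). unfold distortion, defect in Hub. fold A0 B0 in Hub.
    apply (proj1 (Rle_div_l _ _ _ (Rpower_pos _ _))) in Hub. unfold T0. nra. }
  assert (Low : forall w, Cmod w = r -> T0 * c <= 4 * Rpower s (alpha / 2) * Cmod (dpsi w)).
  { intros w Hw. assert (Hw1 : Cmod w < 1) by lra.
    set (A := 1 - Cmod (m w) ^ 2). set (B := 1 - Cmod (psi w) ^ 2).
    assert (HA : 0 < A) by (apply one_sub_sq_pos, Hm, Hw1).
    assert (HB : 0 < B) by (apply one_sub_sq_pos, phi_disk, Hm, Hw1).
    assert (I1 : A0 * (1 - r ^ 2) <= 4 * A).
    { unfold A. rewrite EA, Hw by assumption.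
      pose proof (Hden w Hw1) as Hd. pose proof (den_upper (- z0) w) as Hu. fold (den w) in Hu.
      pose proof (Cmod_ge_0 (- z0)). assert (Hd2 : Cmod (den w) <= 2) by nra.
      assert (Hd4 : Cmod (den w) ^ 2 <= 4) by nra.
      assert (0 < A0 * (1 - r ^ 2)) by (apply Rmult_lt_0_compat; [assumption|nra]).
      replace (4 * (A0 * (1 - r ^ 2) / Cmod (den w) ^ 2))
        with ((4 * (A0 * (1 - r ^ 2))) / Cmod (den w) ^ 2) by (field; lra).
      apply (proj1 (Rle_div_r _ _ _ (pow_lt _ 2 Hd))). nra. }
    assert (I2 : B0 ^ 2 * (1 - r) <= B ^ 2 * (1 + r)).
    { destruct (polar w) as [th Eth]. rewrite Hw in Eth.
      pose proof (half_speed_path psi dpsi (cis th) r (Cmod_cis th) Hr) as HP.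
      rewrite <- Eth in HP. assert (P0 : psi 0 = phi z0) by (unfold psi; rewrite M0; reflexivity).
      rewrite P0 in HP. apply HP.
      intros t Ht. assert (Mt : Cmod (RtoC t * cis th) = t) by (apply Cmod_scal_cis; lra).
      set (w' := (RtoC t * cis th)%C) in *. assert (Hw'1 : Cmod w' < 1) by lra.
      repeat split; [apply Dpsi; assumption|apply phi_disk, Hm; assumption|].
      rewrite <- Mt, Rmult_comm, Edp by assumption.
      specialize (Hsmall w' ltac:(lra)). fold m in Hsmall. unfold defect in Hsmall.
      apply (proj2 (Rle_div_r _ _ _ (proj1 (one_sub_sq_pos _ (Hm w' Hw'1))))) in Hsmall.
      unfold psi. lra. }
    pose proof (power_comparison A A0 B B0 r alpha HA HA0 HB HB0 Hr Ha I1 I2) as PC.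
    replace (8 * (1 - r)) with s in PC by (unfold r; field).
    specialize (Hlow w ltac:(lra)). fold m in Hlow. unfold distortion, defect in Hlow.
    apply (proj2 (Rle_div_r _ _ _ (Rpower_pos _ _))) in Hlow.
    fold A in Hlow. fold (psi w) in Hlow. fold B in Hlow.
    pose proof (Edp w Hw1) as E. fold A in E. rewrite Hw in E.
    fold T0 in PC. pose proof (Rpower_pos s (alpha / 2)) as Hsp0.
    assert (Hx : 0 < 1 - r ^ 2) by nra.
    apply (Rmult_le_reg_r (1 - r ^ 2)); [assumption|].
    apply Rle_trans with (c * (4 * Rpower s (alpha / 2) * (Rpower (B / A) alpha * A))).
    - apply Rle_trans with (c * (T0 * (1 - r ^ 2))); [right; ring|].
      apply Rmult_le_compat_l; lra.
    - replace (4 * Rpower s (alpha / 2) * Cmod (dpsi w) * (1 - r ^ 2))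
        with (4 * Rpower s (alpha / 2) * (Cmod (dpsi w) * (1 - r ^ 2))) by ring.
      rewrite E.
      replace (c * (4 * Rpower s (alpha / 2) * (Rpower (B / A) alpha * A)))
        with (4 * Rpower s (alpha / 2) * ((c * Rpower (B / A) alpha) * A)) by ring.
      apply Rmult_le_compat_l; [lra|]. apply Rmult_le_compat_r; lra. }
  assert (CB : Cmod (/ dpsi 0) <= 4 * Rpower s (alpha / 2) / (T0 * c)).
  { apply (centre_bound (fun w => / dpsi w)%C ((1 + r) / 2) r).
    - intros w [_ Hw]. destruct (Hdp w) as [l Hl]; [lra|]. eexists.
      apply cderiv_inv; [apply Hnz, Hw|exact Hl].
    - intros e He. destruct (Hdp 0 D0) as [l Hl].
      assert (Hn0 : dpsi 0 <> 0) by (apply Hnz; rewrite Cmod_0; lra).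
      destruct (cderiv_cont _ _ _ (cderiv_inv dpsi 0 l Hn0 Hl) e He) as [d [Hd Hcont]].
      exists d; split; [assumption|]. intros w Hw. apply Hcont.
      replace (w - 0)%C with w by ring. exact Hw.
    - lra.
    - intros w Hw. assert (Hnw : dpsi w <> 0) by (apply Hnz; lra).
      rewrite Cmod_inv by assumption. apply Cmod_gt_0 in Hnw as Hpw.
      apply Rle_div_r; [nra|]. rewrite Rmult_comm. apply Rle_div_l; [assumption|].
      apply Low, Hw. }
  assert (Hn0 : dpsi 0 <> 0) by (apply Hnz; rewrite Cmod_0; lra).
  rewrite Cmod_inv in CB by assumption. apply Cmod_gt_0 in Hn0.
  apply (proj2 (Rle_div_r _ _ _ (Rmult_lt_0_compat _ _ HT0 Hc))) in CB.
  rewrite Rmult_comm in CB.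
  apply (proj1 (Rle_div_l _ _ _ Hn0)) in CB.
  pose proof (Rpower_pos s (alpha / 2)) as Hsp0.
  assert (X : T0 * c <= 4 * (c / (8 * M)) * (M * T0)).
  { eapply Rle_trans; [exact CB|]. apply Rmult_le_compat; lra. }
  replace (4 * (c / (8 * M)) * (M * T0)) with (T0 * c / 2) in X by (field; lra).
  nra.
Qed.

End Distortion.

(** With D = 1 + s conj(zeta) w, one has zeta - z = (1 - s) (zeta - w) / D and 1 - |z|^2 = (1 - s^2)
    (1 - |w|^2) / |D|^2. In the ratio 1 - s cancels, so one aperture serves all s, while the second
    bound makes the disks shrink to zeta as s tends to 1. *)
Lemma hyperbolic_disk_in_stolz (zeta w : C) (s R0 : R) : Cmod zeta = 1 -> 0 <= s < 1 ->
  Cmod w < R0 -> R0 < 1 ->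
  let z := blf (- (RtoC s * zeta)) w in
  Cmod (zeta - z) <= 4 / (1 - R0 ^ 2) * (1 - Cmod z ^ 2) /\
  Cmod (zeta - z) <= (1 - s) * 2 / (1 - R0).
Proof.
  intros Hz Hs Hw HR z.
  assert (Mz : Cmod (- (RtoC s * zeta)) = s).
  { rewrite Cmod_opp, Cmod_mult, Cmod_R, Hz, Rabs_pos_eq by lra. ring. }
  assert (Mz1 : Cmod (- (RtoC s * zeta)) < 1) by lra.
  assert (Hw1 : Cmod w < 1) by lra. pose proof (Cmod_ge_0 w) as W0.
  pose proof (den_neq_0 _ _ Mz1 Hw1) as D. apply Cmod_gt_0 in D as Dp.
  pose proof (den_upper (- (RtoC s * zeta)) w) as DU. rewrite Mz in DU.
  pose proof (den_lower (- (RtoC s * zeta)) w) as DL. rewrite Mz in DL.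
  assert (EQ : (zeta - z)%C = (RtoC (1 - s) * (zeta - w) / (1 - Cconj (- (RtoC s * zeta)) * w))%C).
  { unfold z, blf. set (d := (1 - Cconj (- (RtoC s * zeta)) * w)%C) in *.
    assert (Ed : (zeta * d)%C = (zeta + RtoC s * w)%C).
    { unfold d. rewrite Copp_conj, Cmult_conj.
      replace (zeta * (1 - - (Cconj (RtoC s) * Cconj zeta) * w))%C
        with (zeta + Cconj (RtoC s) * (zeta * Cconj zeta) * w)%C by ring.
      rewrite <- Cmod2_conj, Hz.
      replace (Cconj (RtoC s)) with (RtoC s) by (unfold Cconj, RtoC; simpl; f_equal; ring).
      replace (RtoC (1 ^ 2)) with (RtoC 1) by (f_equal; ring). ring. }
    replace zeta with (zeta * d / d)%C at 1 by (field; exact D). rewrite Ed, RtoC_minus.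
    field. exact D. }
  assert (EM : Cmod (zeta - z) = (1 - s) * Cmod (zeta - w) / Cmod (1 - Cconj (- (RtoC s * zeta)) * w)).
  { rewrite EQ, Cmod_div, Cmod_mult, Cmod_R, Rabs_pos_eq by (assumption || lra). reflexivity. }
  assert (ZW : Cmod (zeta - w) <= 2).
  { pose proof (Cmod_sub_triangle zeta w). lra. }
  pose proof (Cmod_ge_0 (zeta - w)) as ZW0.
  rewrite EM. split.
  - unfold z. rewrite blf_mod, Mz by assumption.
    set (d := Cmod (1 - Cconj (- (RtoC s * zeta)) * w)) in *.
    apply Rle_div_l; [assumption|].
    assert (R2 : 0 < 1 - R0 ^ 2) by nra.
    replace (4 / (1 - R0 ^ 2) * ((1 - s ^ 2) * (1 - Cmod w ^ 2) / d ^ 2) * d)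
      with ((1 - s) * (4 * (1 + s) * (1 - Cmod w ^ 2)) / (d * (1 - R0 ^ 2))) by (field; lra).
    apply (proj1 (Rle_div_r _ _ _ (Rmult_lt_0_compat _ _ Dp R2))).
    rewrite Rmult_assoc. apply Rmult_le_compat_l; [lra|].
    assert (d <= 2) by nra.
    apply Rle_trans with (4 * (1 - R0 ^ 2)).
    + rewrite <- Rmult_assoc. apply Rmult_le_compat_r; [lra|]. nra.
    + assert (1 - R0 ^ 2 <= 1 - Cmod w ^ 2) by nra. nra.
  - unfold Rdiv. apply Rmult_le_compat.
    + apply Rmult_le_pos; lra.
    + left; apply Rinv_0_lt_compat; assumption.
    + apply Rmult_le_compat_l; lra.
    + apply Rinv_le_contravar; [lra|]. nra.
Qed.

(** * Boundary behaviour of Blaschke products *)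

Lemma bprod_le_1 (l : list C) (z : C) : (forall a, In a l -> Cmod a < 1) -> Cmod z < 1 ->
  Cmod (bprod l z) <= 1.
Proof.
  intros Hl Hz. induction l as [|a l IH]; simpl; [rewrite Cmod_1; lra|].
  fold (bprod l z). rewrite Cmod_mult.
  pose proof (blf_disk a z (Hl a (or_introl eq_refl)) Hz).
  specialize (IH (fun b Hb => Hl b (or_intror Hb))).
  pose proof (Cmod_ge_0 (blf a z)). pose proof (Cmod_ge_0 (bprod l z)). nra.
Qed.

(** Induction through 1 - x^2 y^2 <= (1 - x^2) + (1 - y^2) for x, y in [0, 1]. *)
Lemma bprod_boundary (l : list C) : (forall a, In a l -> Cmod a < 1) ->
  exists K, 0 <= K /\ forall z, Cmod z < 1 -> 1 - Cmod (bprod l z) ^ 2 <= K * (1 - Cmod z ^ 2).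
Proof.
  induction l as [|a l IH]; intros Hl.
  - exists 0. split; [lra|]. intros z Hz. simpl. rewrite Cmod_1. lra.
  - destruct IH as [K [HK H]]; [intros b Hb; apply Hl; right; exact Hb|].
    assert (Ha : Cmod a < 1) by (apply Hl; left; reflexivity).
    assert (Hi : 0 < / (1 - Cmod a) ^ 2) by (apply Rinv_0_lt_compat, pow_lt; lra).
    exists (/ (1 - Cmod a) ^ 2 + K). split; [lra|]. intros z Hz.
    change (bprod (a :: l) z) with (blf a z * bprod l z)%C. rewrite Cmod_mult.
    specialize (H z Hz). pose proof (one_sub_blf_le a z Ha Hz) as B.
    pose proof (blf_disk a z Ha Hz) as D. pose proof (Cmod_ge_0 (blf a z)).
    assert (P1 : Cmod (bprod l z) <= 1)
      by (apply bprod_le_1; [intros b Hb; apply Hl; right; exact Hb|assumption]).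
    pose proof (Cmod_ge_0 (bprod l z)). unfold Rdiv in B.
    set (x := Cmod (blf a z)) in *. set (y := Cmod (bprod l z)) in *.
    assert (Q1 : 0 <= 1 - x ^ 2) by nra. assert (Q2 : 0 <= 1 - y ^ 2) by nra.
    replace ((x * y) ^ 2) with (x ^ 2 * y ^ 2) by ring. nra.
Qed.

(** The right side is Re (z b' / b) for b = [blf a]. Making the denominator real leaves |z|^2 (1 +
    |a|^2) - Re (conj(a) z) (1 + |z|^2), which factors once Re (conj(a) z) is replaced by |a| |z|;
    16 bounds the product of the two squared denominators. *)
Lemma re_log_deriv_blf (a z : C) : Cmod a < Cmod z -> Cmod z < 1 ->
  (1 - Cmod a ^ 2) * (Cmod z * (Cmod z - Cmod a) * (1 - Cmod z * Cmod a)) / 16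
  <= Re (z * (RtoC (1 - Cmod a ^ 2) / ((1 - Cconj a * z) * (z - a)))).
Proof.
  intros Ha Hz. assert (Ha1 : Cmod a < 1) by lra.
  pose proof (den_neq_0 a z Ha1 Hz) as D.
  pose proof (Cmod_ge_0 a) as A0.
  assert (E : (z - a)%C <> 0).
  { apply Cmod_gt_0. pose proof (Cmod_triangle_inv z a). lra. }
  set (d := (1 - Cconj a * z)%C) in *. set (e := (z - a)%C) in *.
  apply Cmod_gt_0 in D as Dp. apply Cmod_gt_0 in E as Ep.
  assert (Du : Cmod d <= 2) by (unfold d; pose proof (den_upper a z); nra).
  assert (Eu : Cmod e <= 2) by (unfold e; pose proof (Cmod_sub_triangle z a); lra).
  pose proof (one_sub_sq_pos a Ha1) as [k0 _]. set (k := 1 - Cmod a ^ 2) in *.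
  assert (P : 0 < Cmod d ^ 2 * Cmod e ^ 2) by (apply Rmult_lt_0_compat; apply pow_lt; assumption).
  assert (EQ : (z * (RtoC k / (d * e)))%C
     = (RtoC (k / (Cmod d ^ 2 * Cmod e ^ 2)) * (z * (Cconj d * Cconj e)))%C).
  { assert (cd : Cconj d <> 0) by (apply Cmod_gt_0; rewrite Cmod_conj; assumption).
    assert (ce : Cconj e <> 0) by (apply Cmod_gt_0; rewrite Cmod_conj; assumption).
    unfold Rdiv. rewrite RtoC_mult, RtoC_inv by lra. rewrite RtoC_mult, !Cmod2_conj. field.
    repeat split; assumption. }
  rewrite EQ, re_scal_l.
  assert (N : Cmod z * (Cmod z - Cmod a) * (1 - Cmod z * Cmod a) <= Re (z * (Cconj d * Cconj e))).
  { assert (NE : Re (z * (Cconj d * Cconj e))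
       = Cmod z ^ 2 * (1 + Cmod a ^ 2) - Re (Cconj a * z) * (1 + Cmod z ^ 2)).
    { unfold d, e. rewrite !Cmod2_alt. destruct a, z. unfold Re, Im; simpl. ring. }
    rewrite NE. pose proof (Re_le_Cmod (Cconj a * z)) as B. rewrite Cmod_mult, Cmod_conj in B.
    assert (Re (Cconj a * z) * (1 + Cmod z ^ 2) <= Cmod a * Cmod z * (1 + Cmod z ^ 2)); [|nra].
    apply Rmult_le_compat_r; [nra|assumption]. }
  assert (N0 : 0 <= Cmod z * (Cmod z - Cmod a) * (1 - Cmod z * Cmod a)).
  { apply Rmult_le_pos; [apply Rmult_le_pos; lra|nra]. }
  set (n := Cmod z * (Cmod z - Cmod a) * (1 - Cmod z * Cmod a)) in *.
  assert (I : / 16 <= / (Cmod d ^ 2 * Cmod e ^ 2)).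
  { apply Rinv_le_contravar; [assumption|].
    assert (Cmod d ^ 2 <= 4) by nra. assert (Cmod e ^ 2 <= 4) by nra.
    pose proof (pow2_ge_0 (Cmod d)). nra. }
  apply Rle_trans with (k * / (Cmod d ^ 2 * Cmod e ^ 2) * n).
  - unfold Rdiv. replace (k * n * / 16) with ((k * n) * / 16) by ring.
    replace (k * / (Cmod d ^ 2 * Cmod e ^ 2) * n) with ((k * n) * / (Cmod d ^ 2 * Cmod e ^ 2)) by ring.
    apply Rmult_le_compat_l; [nra|assumption].
  - apply Rmult_le_compat_l; [|assumption].
    left. apply Rmult_lt_0_compat; [assumption|apply Rinv_0_lt_compat; assumption].
Qed.

Lemma cderiv_blf_log (a z : C) : Cmod a < Cmod z -> Cmod z < 1 ->
  cderiv (blf a) z (blf a z * (RtoC (1 - Cmod a ^ 2) / ((1 - Cconj a * z) * (z - a)))).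
Proof.
  intros Ha Hz. assert (Ha1 : Cmod a < 1) by lra.
  eapply cderiv_eq; [apply cderiv_blf; assumption|]. unfold blf. field. split.
  - apply Cmod_gt_0. pose proof (Cmod_triangle_inv z a). lra.
  - apply den_neq_0; assumption.
Qed.

(** Logarithmic derivatives add over the factors. All terms have nonnegative real part, so the
    quantitative bound of the first factor alone survives in the sum. *)
Lemma bprod_log_deriv (l : list C) (z : C) : Cmod z < 1 ->
  (forall a, In a l -> Cmod a < Cmod z) ->
  exists L, cderiv (bprod l) z (bprod l z * L) /\ 0 <= Re (z * L) /\
    match l with nil => True | a :: _ =>
      (1 - Cmod a ^ 2) * (Cmod z * (Cmod z - Cmod a) * (1 - Cmod z * Cmod a)) / 16 <= Re (z * L)
    end.
Proof.
  intros Hz. induction l as [|a l IH]; intros Hl.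
  - exists 0. split; [|split; [|exact I]].
    + simpl. eapply cderiv_eq; [apply cderiv_const|ring].
    + rewrite Cmult_0_r. simpl. lra.
  - destruct IH as [L [D [P _]]]; [intros b Hb; apply Hl; right; exact Hb|].
    assert (Ha : Cmod a < Cmod z) by (apply Hl; left; reflexivity).
    set (La := (RtoC (1 - Cmod a ^ 2) / ((1 - Cconj a * z) * (z - a)))%C).
    pose proof (re_log_deriv_blf a z Ha Hz) as B. fold La in B.
    assert (B0 : 0 <= (1 - Cmod a ^ 2) * (Cmod z * (Cmod z - Cmod a) * (1 - Cmod z * Cmod a)) / 16).
    { pose proof (Cmod_ge_0 a). assert (0 <= 1 - Cmod a ^ 2) by nra.
      unfold Rdiv. apply Rmult_le_pos; [|lra]. apply Rmult_le_pos; [assumption|].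
      apply Rmult_le_pos; [apply Rmult_le_pos; lra|nra]. }
    exists (La + L)%C.
    replace (z * (La + L))%C with (z * La + z * L)%C by ring. rewrite re_plus.
    split; [|split; lra].
    change (bprod (a :: l)) with (fun z => blf a z * bprod l z)%C.
    eapply cderiv_eq; [apply cderiv_mult; [apply cderiv_blf_log; assumption|exact D]|].
    cbv beta. fold La. ring.
Qed.

Lemma zeros_radius (l : list C) : (forall a, In a l -> Cmod a < 1) ->
  exists s, 0 <= s < 1 /\ forall a, In a l -> Cmod a <= s.
Proof.
  induction l as [|a l IH]; intros Hl.
  - exists 0. split; [lra|]. intros a [].
  - destruct IH as [s [Hs H]]; [intros b Hb; apply Hl; right; exact Hb|].
    exists (Rmax s (Cmod a)). pose proof (Rmax_l s (Cmod a)). pose proof (Rmax_r s (Cmod a)).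
    split.
    + split; [lra|]. apply Rmax_lub_lt; [lra|apply Hl; left; reflexivity].
    + intros b [<-|Hb]; [assumption|]. specialize (H b Hb). lra.
Qed.

Lemma bprod_deriv_lower (l : list C) : l <> nil -> (forall a, In a l -> Cmod a < 1) ->
  exists eta k, eta < 1 /\ 0 < k /\ forall z, eta < Cmod z < 1 ->
    exists d, cderiv (bprod l) z d /\ k <= Cmod d.
Proof.
  intros Hne Hl. destruct (zeros_radius l Hl) as [s [Hs Has]].
  destruct (bprod_boundary l Hl) as [K [HK HB]].
  (* The first bound keeps |z| half the gap beyond all zeros; the second gives 1 - |bprod l z|^2 <=
     1/2, hence modulus at least 1/2. *)
  set (x := Rmin ((1 - s) / 2) (/ (4 * (K + 1)))).
  assert (Hi : 0 < / (4 * (K + 1))) by (apply Rinv_0_lt_compat; lra).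
  assert (Hx : 0 < x) by (apply Rmin_pos; lra).
  assert (X1 : x <= (1 - s) / 2) by apply Rmin_l.
  assert (X2 : x <= / (4 * (K + 1))) by apply Rmin_r.
  (* (1 - s)^3 / 64 is (1 - s) (1/2) ((1 - s)/2) (1 - s) / 16, the lower bound for |L|; the last 1/2
     is that of the product itself. *)
  exists (1 - x), ((1 - s) ^ 3 / 64 / 2). split; [lra|]. split.
  { assert (0 < (1 - s) ^ 3) by (apply pow_lt; lra). lra. }
  intros z [Hz1 Hz].
  assert (Haz : forall a, In a l -> Cmod a < Cmod z) by (intros a Ha; specialize (Has a Ha); lra).
  destruct (bprod_log_deriv l z Hz Haz) as [L [D [_ P]]].
  exists (bprod l z * L)%C. split; [exact D|]. rewrite Cmod_mult.
  destruct l as [|a l']; [congruence|].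
  assert (Ha : Cmod a <= s) by (apply Has; left; reflexivity). pose proof (Cmod_ge_0 a) as A0.
  assert (PL : (1 - s) ^ 3 / 64 <= Cmod L).
  { apply Rle_trans with (Re (z * L)).
    - eapply Rle_trans; [|exact P].
      assert (Q1 : 1 - s <= 1 - Cmod a ^ 2) by nra.
      assert (Q2 : / 2 <= Cmod z) by lra.
      assert (Q3 : (1 - s) / 2 <= Cmod z - Cmod a) by lra.
      assert (Q4 : 1 - s <= 1 - Cmod z * Cmod a) by nra.
      replace ((1 - s) ^ 3 / 64) with ((1 - s) * (/ 2 * ((1 - s) / 2) * (1 - s)) / 16) by field.
      unfold Rdiv at 1 3. apply Rmult_le_compat_r; [lra|].
      apply Rmult_le_compat; [lra| |assumption|].
      + apply Rmult_le_pos; nra.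
      + apply Rmult_le_compat; [nra|lra| |assumption]. apply Rmult_le_compat; lra.
    - eapply Rle_trans; [apply Re_le_Cmod|]. rewrite Cmod_mult.
      pose proof (Cmod_ge_0 L). nra. }
  assert (PB : / 2 <= Cmod (bprod (a :: l') z)).
  { specialize (HB z Hz). pose proof (Cmod_ge_0 z).
    assert (Z : 1 - Cmod z ^ 2 <= 2 * x) by nra.
    assert (KX : K * (1 - Cmod z ^ 2) <= / 2).
    { apply Rle_trans with ((K + 1) * (2 * / (4 * (K + 1)))).
      - assert (0 <= 1 - Cmod z ^ 2) by nra. apply Rmult_le_compat; lra.
      - right. field. lra. }
    pose proof (Cmod_ge_0 (bprod (a :: l') z)). nra. }
  assert (0 < (1 - s) ^ 3) by (apply pow_lt; lra).
  replace ((1 - s) ^ 3 / 64 / 2) with (/ 2 * ((1 - s) ^ 3 / 64)) by field.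
  apply Rmult_le_compat; lra.
Qed.

(** A supremum argument in place of a finite subcover: let S be the points x for which finitely many
    intervals account for the length x - c. The interval of the cover around sup S would push S
    further, unless d is already reached. *)
Lemma cover_length (a b : nat -> R) (c d e : R) : c <= d -> (forall n, a n <= b n) ->
  (forall N, sum_f_R0 (fun n => b n - a n) N <= e) ->
  (forall x, c <= x <= d -> exists n, a n < x < b n) -> d - c <= e.
Proof.
  intros Hcd Hab Hsum Hcov.
  (* m N x is the total length, with multiplicity, of the first intervals inside [c, x] *)
  set (g := fun x n => Rmax 0 (Rmin x (b n) - Rmax c (a n))).
  set (m := fun N x => sum_f_R0 (g x) N).
  assert (gmono : forall x y n, x <= y -> g x n <= g y n).
  { intros x y n Hxy. unfold g. apply Rle_max_compat_l.
    apply Rplus_le_compat_r, Rle_min_compat_r, Hxy. }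
  assert (gpos : forall x n, 0 <= g x n) by (intros; apply Rmax_l).
  assert (mstep : forall N x y k, (k <= N)%nat -> x <= y -> c <= x -> a k < x -> y < b k ->
     m N x + (y - x) <= m N y).
  { intros N x y k. induction N as [|N IH]; intros Hk Hxy Hc Ha Hb.
    - assert (k = O) by lia. subst k. unfold m; simpl. unfold g.
      rewrite (Rmin_left x), (Rmin_left y) by lra.
      unfold Rmax; repeat destruct (Rle_dec _ _); lra.
    - destruct (Nat.eq_dec k (S N)) as [->|Hne].
      + unfold m; simpl. assert (sum_f_R0 (g x) N <= sum_f_R0 (g y) N).
        { apply sum_Rle. intros; apply gmono, Hxy. }
        assert (g x (S N) + (y - x) <= g y (S N)); [|lra].
        unfold g. rewrite (Rmin_left x), (Rmin_left y) by lra.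
        unfold Rmax; repeat destruct (Rle_dec _ _); lra.
      + specialize (IH ltac:(lia) Hxy Hc Ha Hb). unfold m in *; simpl.
        pose proof (gmono x y (S N) Hxy). lra. }
  assert (mN : forall N N' x, (N <= N')%nat -> m N x <= m N' x).
  { intros N N' x HN. induction HN as [|N' HN IH]; [lra|].
    unfold m in *; simpl. pose proof (gpos x (S N')). lra. }
  set (S := fun x => c <= x <= d /\ exists N, x - c <= m N x).
  assert (Sc : S c).
  { split; [lra|]. exists O. unfold m; simpl. pose proof (gpos c O). lra. }
  destruct (completeness S) as [s [U1 U2]].
  { exists d. intros x [Hx _]. lra. } { exists c; exact Sc. }
  assert (Hs : c <= s <= d).
  { split; [apply U1, Sc|]. apply U2. intros x [Hx _]; lra. }
  destruct (Hcov s Hs) as [k [Hk1 Hk2]].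
  assert (Hx : exists x, S x /\ a k < x <= s).
  { apply NNPP. intros Hno. assert (s <= a k); [|lra]. apply U2. intros x Sx.
    apply Rnot_lt_le; intros Hlt. apply Hno. exists x. split; [assumption|].
    split; [assumption|apply U1, Sx]. }
  destruct Hx as [x [[Hx [N HN]] [Hx1 Hx2]]].
  assert (ext : forall y, x <= y -> y < b k -> y <= d -> S y).
  { intros y Hy1 Hy2 Hy3. split; [lra|]. exists (Nat.max N k).
    pose proof (mstep (Nat.max N k) x y k (Nat.le_max_r _ _) Hy1 (proj1 Hx) Hx1 Hy2).
    pose proof (mN N (Nat.max N k) x (Nat.le_max_l _ _)). lra. }
  assert (Sd : S d).
  { destruct (Rlt_dec d (b k)) as [H|H]; [apply ext; lra|]. exfalso.
    assert (Sy : S ((s + b k) / 2)) by (apply ext; lra). apply U1 in Sy. lra. }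
  destruct Sd as [_ [N' HN']]. eapply Rle_trans; [exact HN'|].
  eapply Rle_trans; [|apply (Hsum N')]. apply sum_Rle. intros n _. unfold g.
  specialize (Hab n). apply Rmax_lub; [lra|].
  pose proof (Rmin_r d (b n)). pose proof (Rmax_r c (a n)). lra.
Qed.

Lemma cis_continuous (t e : R) : 0 < e -> exists d, 0 < d /\
  forall u, Rabs (u - t) < d -> Cmod (cis u - cis t) < e.
Proof.
  intros He.
  destruct (continuity_cos t (e / 2) ltac:(lra)) as [d1 [H1 K1]].
  destruct (continuity_sin t (e / 2) ltac:(lra)) as [d2 [H2 K2]].
  simpl in *. unfold Rdist, D_x, no_cond in *.
  exists (Rmin d1 d2). split; [apply Rmin_pos; assumption|]. intros u Hu.
  pose proof (Rmin_l d1 d2). pose proof (Rmin_r d1 d2).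
  destruct (Req_dec u t) as [->|Hne].
  { rewrite Csub_diag, Cmod_0. assumption. }
  specialize (K1 u). specialize (K2 u).
  assert (A1 : Rabs (cos u - cos t) < e / 2) by (apply K1; repeat split; auto; lra).
  assert (A2 : Rabs (sin u - sin t) < e / 2) by (apply K2; repeat split; auto; lra).
  eapply Rle_lt_trans; [apply Cmod_2Rmax|].
  assert (Rmax (Rabs (fst (cis u - cis t)%C)) (Rabs (snd (cis u - cis t)%C)) < e / 2)
    by (apply Rmax_lub_lt; assumption).
  pose proof (sqrt_sqrt 2 ltac:(lra)). pose proof (sqrt_pos 2).
  assert (sqrt 2 <= 2) by nra.
  assert (0 <= Rmax (Rabs (fst (cis u - cis t)%C)) (Rabs (snd (cis u - cis t)%C))).
  { eapply Rle_trans; [apply Rabs_pos|apply Rmax_l]. }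
  nra.
Qed.

(** * The characterization *)

Require Import Defs.

Lemma Defs_Cmod (z : C) : Defs.Cmod z = Complex.Cmod z.
Proof. unfold Defs.Cmod, Complex.Cmod, Cnorm2. f_equal. ring. Qed.

Lemma Defs_Cdiv (z w : C) : Defs.Cdiv z w = (z / w)%C.
Proof.
  unfold Defs.Cdiv, Defs.Cinv, Cnorm2, Complex.Cdiv, Complex.Cinv.
  replace (fst w * fst w + snd w * snd w) with (fst w ^ 2 + snd w ^ 2) by ring. reflexivity.
Qed.

Lemma Defs_blaschke (c : C) (l : list C) (z : C) : blaschke c l z = (c * bprod l z)%C.
Proof.
  unfold blaschke. change Cmul with Cmult. f_equal.
  induction l as [|a l IH]; simpl; [reflexivity|]. rewrite IH. unfold bprod at 1.
  change Cmul with Cmult. f_equal. unfold blaschke_factor. rewrite Defs_Cdiv. reflexivity.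
Qed.

Lemma has_cderiv_cderiv (f : C -> C) (z l : C) : has_cderiv f z l -> cderiv f z l.
Proof.
  intros H eps He. destruct (H eps He) as [d [Hd K]]. exists d; split; [assumption|].
  intros w Hw. destruct (Ceq_dec w z) as [->|E].
  - replace (f z - f z - l * (z - z))%C with (RtoC 0) by ring.
    rewrite Csub_diag, Cmod_0. lra.
  - assert (E' : (w - z)%C <> 0) by (intros X; apply E, Ceq_minus, X).
    apply Cmod_gt_0 in E' as P. specialize (K w). rewrite !Defs_Cmod, Defs_Cdiv in K.
    change (Csub w z) with (w - z)%C in K. change (Csub (f w) (f z)) with (f w - f z)%C in K.
    specialize (K (conj P Hw)).
    change (Csub ((f w - f z) / (w - z))%C l) with ((f w - f z) / (w - z) - l)%C in K.
    replace (f w - f z - l * (w - z))%C with (((f w - f z) / (w - z) - l) * (w - z))%C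
      by (field; exact E').
    rewrite Cmod_mult. apply Rmult_le_compat_r; lra.
Qed.

Lemma tau_distortion (phi dphi : C -> C) (alpha : R) (z : C) :
  Complex.Cmod z < 1 -> Complex.Cmod (phi z) < 1 ->
  tau phi dphi alpha z = distortion phi dphi alpha z.
Proof.
  intros Hz Hp. unfold tau, distortion, defect. rewrite !Defs_Cmod.
  pose proof (one_sub_sq_pos _ Hz) as [A _]. pose proof (one_sub_sq_pos _ Hp) as [B _].
  rewrite <- (Rpower_div_mult _ _ alpha B A).
  pose proof (Rpower_pos (1 - Complex.Cmod z ^ 2) alpha).
  pose proof (Rpower_pos ((1 - Complex.Cmod (phi z) ^ 2) / (1 - Complex.Cmod z ^ 2)) alpha).
  field. lra.
Qed.

Lemma null_set_avoid (E : R -> Prop) (a b : R) : null_set E -> a < b ->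
  exists t, a < t < b /\ ~ E t.
Proof.
  intros HE Hab. apply NNPP. intros Hno.
  (* The closed middle half of (a, b) has length (b - a) / 2, too long for a cover of total length
     (b - a) / 4. *)
  destruct (HE ((b - a) / 4)) as [u [v [H1 [H2 H3]]]]; [lra|].
  assert (b - (b - a) / 4 - (a + (b - a) / 4) <= (b - a) / 4); [|lra].
  apply (cover_length u v); [lra|assumption|assumption|].
  intros x Hx. apply H3. apply NNPP. intros Hn. apply Hno. exists x. split; [lra|exact Hn].
Qed.

Lemma ae_circle_dense (P : C -> Prop) (t d : R) : ae_circle P -> 0 < d ->
  exists u, P (cis u) /\ Complex.Cmod (cis u - cis t) < d.
Proof.
  intros HP Hd. destruct (cis_continuous t d Hd) as [e [He K]].
  destruct (null_set_avoid _ (t - e) (t + e) HP) as [u [Hu Hn]]; [lra|].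
  exists u. split; [apply NNPP, Hn|]. apply K. apply Rabs_def1; lra.
Qed.

Section Main.
Variables phi dphi : C -> C.
Hypothesis phi_deriv : forall z, Complex.Cmod z < 1 -> cderiv phi z (dphi z).
Hypothesis phi_disk : forall z, Complex.Cmod z < 1 -> Complex.Cmod (phi z) < 1.

Lemma stolz_distortion (alpha c gamma : R) (zeta : C) :
  ang_liminf_ge (tau phi dphi alpha) zeta c -> 0 < c -> 1 < gamma ->
  exists d, 0 < d /\ forall z, Complex.Cmod z < 1 ->
    Complex.Cmod (zeta - z) <= gamma * (1 - Complex.Cmod z ^ 2) ->
    Complex.Cmod (zeta - z) < d -> c / 2 <= distortion phi dphi alpha z.
Proof.
  intros H Hc Hg. destruct (H gamma Hg (c / 2)) as [d [Hd K]]; [lra|].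
  exists d; split; [assumption|]. intros z Hz H1 H2.
  rewrite <- (tau_distortion phi dphi alpha z Hz (phi_disk z Hz)).
  replace (c / 2) with (c - c / 2) by lra. apply K.
  - split; [unfold in_disk|]; rewrite ?Defs_Cmod; assumption.
  - rewrite Defs_Cmod. change (Csub z zeta) with (z - zeta)%C.
    rewrite Cmod_sub_sym. exact H2.
Qed.

(** The bound depends on neither zeta nor e, the uniformity that Julia's lemma needs. The entries of
    the maximum serve alpha > 1 and alpha < 1; [Rmax M 1] supplies a positive upper bound. *)
Lemma defect_bounded_near (alpha c M : R) (zeta : C) (e : R) :
  0 < alpha -> alpha <> 1 -> 0 < c ->
  (forall z, Complex.Cmod z < 1 -> distortion phi dphi alpha z <= M) ->
  Complex.Cmod zeta = 1 -> ang_liminf_ge (tau phi dphi alpha) zeta c -> 0 < e ->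
  exists z, Complex.Cmod z < 1 /\ Complex.Cmod (zeta - z) < e /\
    defect phi z <= Rmax (Rpower (/ (c / 2)) (/ (alpha - 1)))
                         (Rpower (2 * Rmax M 1) (/ (1 - alpha))).
Proof.
  intros Ha Ha1 Hc HM Hz Hang He.
  destruct (Rlt_dec 1 alpha) as [Hgt|Hle].
  (* Radial points (1 - x) zeta lie at distance x from zeta, well inside aperture 2. *)
  - destruct (stolz_distortion alpha c 2 zeta Hang Hc ltac:(lra)) as [d [Hd K]].
    set (x := Rmin (/ 2) (Rmin (d / 2) (e / 2))).
    assert (Hx : 0 < x) by (repeat apply Rmin_pos; lra).
    assert (X1 : x <= / 2) by apply Rmin_l.
    assert (X2 : x <= d / 2) by (eapply Rle_trans; [apply Rmin_r|apply Rmin_l]).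
    assert (X3 : x <= e / 2) by (eapply Rle_trans; [apply Rmin_r|apply Rmin_r]).
    set (z := (RtoC (1 - x) * zeta)%C).
    assert (Mz : Complex.Cmod z = 1 - x).
    { unfold z. rewrite Cmod_mult, Cmod_R, Hz, Rabs_pos_eq by lra. ring. }
    assert (Mzz : Complex.Cmod (zeta - z) = x).
    { replace (zeta - z)%C with (RtoC x * zeta)%C by (unfold z; rewrite RtoC_minus; ring).
      rewrite Cmod_mult, Cmod_R, Hz, Rabs_pos_eq by lra. ring. }
    assert (Dz : Complex.Cmod z < 1) by lra.
    exists z. split; [assumption|]. split; [lra|].
    eapply Rle_trans; [|apply Rmax_l].
    apply (defect_bound_gt1 phi dphi phi_deriv phi_disk alpha (c / 2)); [assumption|lra|assumption|].
    apply K; [assumption| |lra]. rewrite Mzz, Mz. nra.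
  - assert (Ha' : 0 < alpha < 1) by lra.
    set (M' := Rmax M 1). assert (HM1 : 1 <= M') by apply Rmax_r.
    assert (HM' : forall z, Complex.Cmod z < 1 -> distortion phi dphi alpha z <= M').
    { intros z Hzz. eapply Rle_trans; [apply HM, Hzz|apply Rmax_l]. }
    destruct (exists_large_distortion phi dphi phi_deriv phi_disk alpha (c / 2) M')
      as [r [Hr K1]]; [assumption|lra|lra|assumption|].
    set (R0 := (1 + r) / 2) in *. assert (HR : 0 < R0 < 1) by (unfold R0; lra).
    assert (HR2 : 0 < 1 - R0 ^ 2 < 1) by nra.
    (* The aperture is dictated by r, hence by alpha, c and M; it must contain the whole hyperbolic
       disk, which is where the freedom in gamma is used. *)
    destruct (stolz_distortion alpha c (4 / (1 - R0 ^ 2)) zeta Hang Hc) as [d [Hd K]].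
    { apply (proj1 (Rlt_div_r _ _ _ (proj1 HR2))). lra. }
    set (y := Rmin 1 (Rmin d e)).
    assert (Hy : 0 < y) by (repeat apply Rmin_pos; lra).
    assert (Y1 : y <= 1) by apply Rmin_l.
    assert (Y2 : y <= d) by (eapply Rle_trans; [apply Rmin_r|apply Rmin_l]).
    assert (Y3 : y <= e) by (eapply Rle_trans; [apply Rmin_r|apply Rmin_r]).
    (* This s puts the image of the disk |w| < R0 within y / 2 of zeta. *)
    set (s := 1 - y * (1 - R0) / 4).
    assert (Hs : 0 <= s < 1) by (unfold s; nra).
    assert (Es : (1 - s) * 2 / (1 - R0) = y / 2) by (unfold s; field; lra).
    set (z0 := (RtoC s * zeta)%C).
    assert (Hz0 : Complex.Cmod z0 < 1).
    { unfold z0. rewrite Cmod_mult, Cmod_R, Hz, Rabs_pos_eq by lra. lra. }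
    assert (Hz0' : Complex.Cmod (- z0) < 1) by (rewrite Cmod_opp; exact Hz0).
    assert (G : forall w, Complex.Cmod w < R0 ->
      Complex.Cmod (zeta - blf (- z0) w) <= 4 / (1 - R0 ^ 2) * (1 - Complex.Cmod (blf (- z0) w) ^ 2)
      /\ Complex.Cmod (zeta - blf (- z0) w) <= y / 2).
    { intros w Hw. rewrite <- Es. apply hyperbolic_disk_in_stolz; (assumption || lra). }
    destruct (K1 z0 Hz0) as [w [Hw Hdw]].
    { intros w Hw. destruct (G w Hw) as [G1 G2].
      apply K; [apply blf_disk; [assumption|lra]|assumption|lra]. }
    assert (Hw1 : Complex.Cmod w < R0) by (unfold R0; lra).
    destruct (G w Hw1) as [_ G2].
    assert (Dz : Complex.Cmod (blf (- z0) w) < 1) by (apply blf_disk; [assumption|lra]).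
    exists (blf (- z0) w). split; [assumption|]. split; [lra|].
    eapply Rle_trans; [|apply Rmax_r].
    apply (defect_bound_lt1 phi dphi phi_disk alpha M'); try assumption. apply HM', Dz.
Qed.

Lemma blaschke_of_distortion (alpha c M : R) : 0 < alpha -> alpha <> 1 -> 0 < c ->
  (forall z, Complex.Cmod z < 1 -> distortion phi dphi alpha z <= M) ->
  ae_circle (fun zeta => ang_liminf_ge (tau phi dphi alpha) zeta c) ->
  is_finite_blaschke phi.
Proof.
  intros Ha Ha1 Hc HM Hae.
  set (K := Rmax (Rpower (/ (c / 2)) (/ (alpha - 1))) (Rpower (2 * Rmax M 1) (/ (1 - alpha)))).
  assert (Hholo : holo phi) by (intros z Hz; exists (dphi z); apply phi_deriv, Hz).
  destruct (finite_blaschke_of_boundary phi (8 * K) Hholo) as [k [l [Hk [Hl E]]]].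
  - intros z Hz. left. apply phi_disk, Hz.
  - apply (julia phi K Hholo phi_disk). intros t d Hd.
    destruct (ae_circle_dense _ t (d / 2) Hae) as [u [Hu Hut]]; [lra|].
    destruct (defect_bounded_near alpha c M (cis u) (d / 2)) as [z [Hz [Hzu HK]]];
      try assumption; [apply Cmod_cis|lra|].
    exists z. split; [assumption|]. split.
    + eapply Rle_lt_trans; [apply (ball_triangle (cis t) (cis u) z)|].
      rewrite Cmod_sub_sym. lra.
    + unfold defect in HK. fold K in HK.
      apply (proj1 (Rle_div_l _ _ _ (proj1 (one_sub_sq_pos z Hz)))). exact HK.
  - exists k, l. rewrite Defs_Cmod. split; [assumption|]. split.
    + intros a Hin. unfold in_disk. rewrite Defs_Cmod. apply Hl, Hin.
    + intros z Hz. unfold in_disk in Hz. rewrite Defs_Cmod in Hz.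
      rewrite Defs_blaschke. apply E, Hz.
Qed.

(** Schwarz-Pick between 0 and z, together with |1 - conj(phi 0) phi z| >= 1 - |phi 0|. *)
Lemma defect_lower : exists m, 0 < m /\ forall z, Complex.Cmod z < 1 -> m <= defect phi z.
Proof.
  assert (D0 : Complex.Cmod 0 < 1) by (rewrite Cmod_0; lra).
  pose proof (phi_disk 0 D0) as P0. set (p := Complex.Cmod (phi 0)) in *.
  exists ((1 - p) ^ 2). split; [apply pow_lt; lra|]. intros z Hz.
  assert (Hholo : holo phi) by (intros w Hw; exists (dphi w); apply phi_deriv, Hw).
  pose proof (schwarz_pick phi Hholo phi_disk 0 z D0 Hz) as SP.
  pose proof (den_lower_disk (phi 0) (phi z) P0 (phi_disk z Hz)) as DL. fold p in DL.
  rewrite Cmod_0 in SP. fold p in SP.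
  replace (1 - Complex.Cconj 0 * z)%C with (RtoC 1) in SP
    by (unfold Complex.Cconj; simpl; rewrite Ropp_0; change (0, 0) with (RtoC 0); ring).
  rewrite Cmod_1 in SP.
  pose proof (one_sub_sq_pos z Hz) as [A _].
  pose proof (one_sub_sq_pos _ (phi_disk z Hz)) as [B _].
  unfold defect. apply (proj1 (Rle_div_r _ _ _ A)).
  assert (Hp : 0 <= p) by apply Cmod_ge_0.
  assert (Q : (1 - p) ^ 2 <= Complex.Cmod (1 - Complex.Cconj (phi 0) * phi z) ^ 2)
    by (apply pow_incr; lra).
  apply Rle_trans with
    ((1 - Complex.Cmod z ^ 2) * Complex.Cmod (1 - Complex.Cconj (phi 0) * phi z) ^ 2).
  - rewrite Rmult_comm. apply Rmult_le_compat_l; lra.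
  - nra.
Qed.

(** At alpha = 2, |phi'| <= u gives tau <= 1 / u, and u is bounded below; near the circle |phi'| >=
    q and u <= K + 1, where the 1 guards against K = 0. *)
Lemma distortion_of_blaschke (k : C) (l : list C) : Complex.Cmod k = 1 -> l <> nil ->
  (forall a, In a l -> Complex.Cmod a < 1) ->
  (forall z, Complex.Cmod z < 1 -> phi z = (k * bprod l z)%C) ->
  exists c M eta, 0 < c /\ eta < 1 /\
    forall z, Complex.Cmod z < 1 -> distortion phi dphi 2 z <= M /\
      (eta < Complex.Cmod z -> c <= distortion phi dphi 2 z).
Proof.
  intros Hk Hne Hl E.
  assert (R2 : forall x, 0 < x -> Rpower x 2 = x ^ 2).
  { intros x Hx. rewrite <- (Rpower_pow 2 x Hx). reflexivity. }
  destruct defect_lower as [m [Hm Hlow]].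
  destruct (bprod_boundary l Hl) as [K [HK HB]].
  destruct (bprod_deriv_lower l Hne Hl) as [eta [q [Heta [Hq HD]]]].
  exists (q / (K + 1) ^ 2), (/ m), eta. split; [|split; [assumption|]].
  { apply Rdiv_lt_0_compat; [assumption|apply pow_lt; lra]. }
  intros z Hz. pose proof (defect_pos phi phi_disk z Hz) as Hx. unfold distortion.
  rewrite R2 by assumption. split.
  - apply Rle_trans with (/ defect phi z).
    + pose proof (deriv_le_defect phi dphi phi_deriv phi_disk z Hz).
      apply (proj2 (Rle_div_l _ _ _ (pow_lt _ 2 Hx))).
      replace (/ defect phi z * defect phi z ^ 2) with (defect phi z) by (field; lra). assumption.
    + apply Rinv_le_contravar; [assumption|apply Hlow, Hz].
  - intros Hez. destruct (HD z (conj Hez Hz)) as [d [Dd Hqd]].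
    assert (Ed : dphi z = (k * d)%C).
    { apply (cderiv_unique phi z); [apply phi_deriv, Hz|].
      apply (cderiv_ext (fun w => k * bprod l w)%C phi z _ (1 - Complex.Cmod z)); [lra| |].
      - intros w Hw. symmetry. apply E. apply (disk_ball z), Hw.
      - apply cderiv_scal, Dd. }
    rewrite Ed, Cmod_mult, Hk, Rmult_1_l.
    assert (Hub : defect phi z <= K + 1).
    { unfold defect. pose proof (one_sub_sq_pos z Hz) as [A _].
      apply (proj2 (Rle_div_l _ _ _ A)). rewrite E, Cmod_mult, Hk, Rmult_1_l by assumption.
      specialize (HB z Hz). nra. }
    unfold Rdiv. apply Rmult_le_compat; [lra| |assumption|].
    + left. apply Rinv_0_lt_compat, pow_lt. lra.
    + apply Rinv_le_contravar; [apply pow_lt; assumption|apply pow_incr; lra].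
Qed.
End Main.

Theorem theorem1 (phi dphi : Cplx -> Cplx)
  (Hderiv : forall z, in_disk z -> has_cderiv phi z (dphi z))
  (Hmaps : forall z, in_disk z -> in_disk (phi z))
  (Hnonconst : exists z w, in_disk z /\ in_disk w /\ phi z <> phi w) :
  is_finite_blaschke phi <->
  exists alpha c : R, 0 < alpha /\ alpha <> 1 /\ 0 < c /\
    (exists M, forall z, in_disk z -> tau phi dphi alpha z <= M) /\
    ae_circle (fun zeta => ang_liminf_ge (tau phi dphi alpha) zeta c).
Proof.
  assert (ID : forall z : C, in_disk z <-> Complex.Cmod z < 1)
    by (intros z; unfold in_disk; rewrite Defs_Cmod; tauto).
  assert (HD : forall z, Complex.Cmod z < 1 -> cderiv phi z (dphi z))
    by (intros z Hz; apply has_cderiv_cderiv, Hderiv, ID, Hz).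
  assert (HP : forall z, Complex.Cmod z < 1 -> Complex.Cmod (phi z) < 1)
    by (intros z Hz; apply ID, Hmaps, ID, Hz).
  assert (HT : forall alpha z, Complex.Cmod z < 1 ->
    tau phi dphi alpha z = distortion phi dphi alpha z)
    by (intros alpha z Hz; apply tau_distortion; [exact Hz|apply HP, Hz]).
  split.
  - intros [k [l [Hk [Hl E]]]]. rewrite Defs_Cmod in Hk.
    assert (E' : forall z, Complex.Cmod z < 1 -> phi z = (k * bprod l z)%C)
      by (intros z Hz; rewrite <- Defs_blaschke; apply E, ID, Hz).
    (* An empty product would make phi the constant k. *)
    assert (Hne : l <> nil).
    { intros ->. destruct Hnonconst as [z [w [Hz [Hw Hzw]]]]. apply Hzw.
      rewrite !E' by (apply ID; assumption). reflexivity. }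
    destruct (distortion_of_blaschke phi dphi HD HP k l Hk Hne
      (fun a Ha => proj1 (ID a) (Hl a Ha)) E') as [c [M [eta [Hc [Heta H]]]]].
    exists 2, c. split; [lra|]. split; [lra|]. split; [assumption|]. split.
    + exists M. intros z Hz. apply ID in Hz. rewrite HT by assumption. apply H, Hz.
    (* The exceptional set is empty, so degenerate intervals cover it. *)
    + intros eps He. exists (fun _ => 0), (fun _ => 0). split; [intros; lra|]. split.
      * intros N. rewrite (sum_eq _ (fun _ => 0)) by (intros; ring).
        rewrite sum_cte. lra.
      * intros t Ht. exfalso. apply Ht. intros gamma Hg e Hepos.
        (* Distance below 1 - eta from a point of the circle forces |z| > eta. *)
        exists (1 - eta). split; [lra|]. intros z [Hz _] Hd.
        apply ID in Hz. rewrite HT by assumption.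
        assert (eta < Complex.Cmod z).
        { rewrite Defs_Cmod in Hd. change (Csub z (Cexpi t)) with (z - cis t)%C in Hd.
          rewrite Cmod_sub_sym in Hd. pose proof (Cmod_triangle_inv (cis t) z).
          rewrite Cmod_cis in H0. lra. }
        destruct (H z Hz) as [_ Hlow]. specialize (Hlow H0). lra.
  - intros [alpha [c [Ha [Ha1 [Hc [[M HM] Hae]]]]]].
    apply (blaschke_of_distortion phi dphi HD HP alpha c M); try assumption.
    intros z Hz. rewrite <- HT by assumption. apply HM, ID, Hz.
Qed.
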